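(* Let $E$ be a solid translation-invariant Banach function space of bounded type on $\mathbb{R}^n$, let $\mathfrak{M},\mathfrak{N}$ be weight sequence systems and let $\mathcal{W},\mathcal{V}$ be weight function systems. Assume that $\mathfrak{M}$ is log-convex and satisfies $[\mathrm{L}]$ and $[\mathrm{I}]$, $\mathfrak{N}$ satisfies $[\mathrm{L}]$ and $[\mathrm{wI}]$, and $\mathcal{W}$ and $\mathcal{V}$ satisfy $[\mathrm{wM}]$. Suppose that $E^{[\mathfrak{M}]}_{[\mathcal{W}]}\neq\{0\}$. If $E^{[\mathfrak{M}]}_{[\mathcal{W}]}\subseteq E^{[\mathfrak{N}]}_{[\mathcal{V}]}$ as sets, then $\mathfrak{M}\,[\subseteq]\,\mathfrak{N}$.
   Context: Conventions: $\mathbb{N}=\{0,1,2,\dots\}$, $\mathbb{R}_+=(0,\infty)$, $T_xf(t)=f(t-x)$, $B(0,1)=\{x\in\mathbb{R}^n:|x|<1\}$. The symbol $[\,\cdot\,]$ is a common notation for $(\,\cdot\,)$ (Beurling case) and $\{\,\cdot\,\}$ (Roumieu case): the statement is asserted twice, once with all $[\,\cdot\,]$ replaced by $(\,\cdot\,)$ and once with all replaced by $\{\,\cdot\,\}$. Banach function spaces. A Banach space $E$ is a translation-invariant Banach function space (TIBF) of bounded type on $\mathbb{R}^n$ if $E\neq\{0\}$, $E\subseteq L^1_{\mathrm{loc}}(\mathbb{R}^n)$ continuously, $T_xE\subseteq E$ for all $x\in\mathbb{R}^n$, there is $C_0>0$ with $\|T_xf\|_E\le C_0\|f\|_E$ for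 all $x\in\mathbb{R}^n$, $f\in E$, and $E*C_c(\mathbb{R}^n)\subseteq E$. It is solid if $f\in E$, $g\in L^1_{\mathrm{loc}}(\mathbb{R}^n)$ and $|g|\le|f|$ a.e. imply $g\in E$ and $\|g\|_E\le\|f\|_E$. Weight function systems. A weight function is a continuous $w:\mathbb{R}^n\to[1,\infty)$. A weight function system is a family $\mathcal{W}=\{w^\lambda:\lambda\in\mathbb{R}_+\}$ of weight functions with $w^\lambda\le w^\mu$ pointwise whenever $\mu\le\lambda$ (and $\mathcal{V}=\{v^\lambda:\lambda\in\mathbb{R}_+\}$). Conditions ($\lambda,\mu,\nu$ range over $\mathbb{R}_+$): $(\mathrm{wM})$: $\forall\lambda\,\exists\mu\,\exists C>0\,\forall x\in\mathbb{R}^n,y\in B(0,1)$: $w^\lambda(x+y)\le Cw^\mu(x)$. $\{\mathrm{wM}\}$: $\forall\mu\,\exists\lambda\,\exists C>0\,\forall x\in\mathbb{R}^n,y\in B(0,1)$: $w^\lambda(x+y)\le Cw^\mu(x)$. Weight sequence systems. A weight sequence is a family $M=(M_\alpha)_{\alpha\in\mathbb{N}^n}$ of positive numbers with $M_0=1$ and $\lim_{|\alpha|\to\infty}M_\alpha^{1/|\alpha|}=\infty$; it is log-convex if there is a convex $F:[0,\infty)^n\to\mathbb{R}$ with $F(\alpha)=\log M_\alpha$ for all $\alpha\in\mathbb{N}^n$. A weight sequence system is a family $\mathfrak{M}=\{M^\lambda:\lambda\in\mathbb{R}_+\}$ of weight sequences with $M^\lambda_\alpha\le M^\mu_\alpha$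 for all $\alpha$ whenever $\lambda\le\mu$ (and $\mathfrak{N}=\{N^\lambda\}$); it is log-convex if each $M^\lambda$ is. Conditions: $(\mathrm{L})$: $\forall R>0\,\forall\lambda\,\exists\mu\,\exists C>0\,\forall\alpha$: $R^{|\alpha|}M^\mu_\alpha\le CM^\lambda_\alpha$. $\{\mathrm{L}\}$: $\forall R>0\,\forall\mu\,\exists\lambda\,\exists C>0\,\forall\alpha$: $R^{|\alpha|}M^\mu_\alpha\le CM^\lambda_\alpha$. $(\mathrm{wI})$: $\forall\lambda\,\exists\mu\,\exists H>0\,\forall R>0\,\exists C>0\,\forall\alpha,\beta$: $M^\mu_\alpha R^{|\beta|}\le CH^{|\alpha+\beta|}M^\lambda_{\alpha+\beta}$. $\{\mathrm{wI}\}$: $\forall\mu\,\exists\lambda\,\exists H>0\,\forall R>0\,\exists C>0\,\forall\alpha,\beta$: $M^\mu_\alpha R^{|\beta|}\le CH^{|\alpha+\beta|}M^\lambda_{\alpha+\beta}$. $(\mathrm{I})$: $\forall\lambda\,\exists\mu,\nu\,\exists C,H>0\,\forall\alpha,\beta$: $M^\mu_\alpha M^\nu_\beta\le CH^{|\alpha+\beta|}M^\lambda_{\alpha+\beta}$. $\{\mathrm{I}\}$: $\forall\mu,\nu\,\exists\lambda\,\exists C,H>0\,\forall\alpha,\beta$: $M^\mu_\alpha M^\nu_\beta\le CH^{|\alpha+\beta|}M^\lambda_{\alpha+\beta}$. $\mathfrak{M}(\subseteq)\mathfrak{N}$ means $\forall\lambda\,\exists\mu\,\exists C>0\,\forall\alpha$: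 $M^\mu_\alpha\le CN^\lambda_\alpha$; $\mathfrak{M}\{\subseteq\}\mathfrak{N}$ means $\forall\mu\,\exists\lambda\,\exists C>0\,\forall\alpha$: $M^\mu_\alpha\le CN^\lambda_\alpha$. Spaces. For a weight sequence $M$ and a weight function $w$, $E^M_w$ is the Banach space of all $f\in C^\infty(\mathbb{R}^n)$ with $f^{(\alpha)}w\in E$ for all $\alpha\in\mathbb{N}^n$ and $\|f\|_{E,M,w}=\sup_\alpha\|f^{(\alpha)}w\|_E/M_\alpha<\infty$. Then $E^{(\mathfrak{M})}_{(\mathcal{W})}=\varprojlim_{\lambda\to0^+}E^{M^\lambda}_{w^\lambda}$ (intersection over all $\lambda$, projective limit topology) and $E^{\{\mathfrak{M}\}}_{\{\mathcal{W}\}}=\varinjlim_{\lambda\to\infty}E^{M^\lambda}_{w^\lambda}$ (union over all $\lambda$, locally convex inductive limit topology). *)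

(* Defs.v *)
From HB Require Import structures.
From mathcomp Require Import all_boot all_order all_algebra.
From mathcomp Require Import all_classical all_reals all_analysis.
From mathcomp Require Import complex.

Set Implicit Arguments.
Unset Strict Implicit.
Unset Printing Implicit Defensive.

Import Order.TTheory GRing.Theory Num.Theory.
Import numFieldNormedType.Exports.

Local Open Scope classical_set_scope.
Local Open Scope ring_scope.

Definition box {R : realType} {n : nat} (ab : 'rV[R]_n * 'rV[R]_n) :
    set 'rV[R]_n :=
  [set x | forall i, ab.1 0 i <= x 0 i <= ab.2 0 i].

Definition box_volume {R : realType} {n : nat}
    (ab : 'rV[R]_n * 'rV[R]_n) : R :=
  \prod_(i < n) Num.max 0 (ab.2 0 i - ab.1 0 i).

(* Covers are indexed by arbitrary sets [D] of naturals, so that finite and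
   empty covers are allowed (for [n = 0] no box is empty). *)
Definition lebesgue_outer {R : realType} {n : nat} (A : set 'rV[R]_n) :
    \bar R :=
  ereal_inf [set v | exists D : set nat,
    exists F : nat -> 'rV[R]_n * 'rV[R]_n,
      A `<=` \bigcup_(k in D) box (F k) /\
      v = \esum_(k in D) (box_volume (F k))%:E]%E.

Section lebesgue_outer_measure.
Context (R : realType) (n : nat).
Local Open Scope ereal_scope.
Implicit Types A : set 'rV[R]_n.

Lemma box_volume_ge0 (ab : 'rV[R]_n * 'rV[R]_n) : (0 <= box_volume ab)%R.
Proof. by apply: prodr_ge0 => i _; rewrite le_max lexx. Qed.

Let lo_ge0 A : 0 <= lebesgue_outer A.
Proof.
apply: le_ereal_inf_tmp => _ [D [F [_ ->]]].
by apply: esum_ge0 => k _; rewrite lee_fin box_volume_ge0.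
Qed.

Let lo0 : lebesgue_outer (set0 : set 'rV[R]_n) = 0.
Proof.
apply/eqP; rewrite eq_le lo_ge0 andbT; apply: ereal_inf_lbound.
by exists set0, (fun=> (0%R, 0%R)); split => //; rewrite esum_set0.
Qed.

Let lo_le : {homo (@lebesgue_outer R n) : A B / A `<=` B >-> A <= B}.
Proof.
move=> A B AB; apply/ereal_inf_le_tmp => _ [D [F [BD ->]]].
by exists D, F; split => //; exact: subset_trans BD.
Qed.

Let lo_sigma : sigma_subadditive (@lebesgue_outer R n).
Proof.
move=> A; have [[i ioo]|] := pselect (exists i, lebesgue_outer (A i) = +oo).
  by rewrite (eseries_pinfty _ _ ioo) ?leey// => k _;
    rewrite -ltNye (lt_le_trans _ (lo_ge0 _)).
rewrite -forallNE => Aoo.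
suff add2e (e : {posnum R}) : lebesgue_outer (\bigcup_k A k) <=
    \sum_(i <oo) lebesgue_outer (A i) + e%:num%:E.
  by apply/lee_addgt0Pr => _/posnumP[].
rewrite (le_trans _ (epsilon_trick _ _ _))//.
pose P k (G : set nat * (nat -> 'rV[R]_n * 'rV[R]_n)) :=
  A k `<=` \bigcup_(j in G.1) box (G.2 j) /\
  \esum_(j in G.1) (box_volume (G.2 j))%:E <=
    lebesgue_outer (A k) + (e%:num / (2 ^ k.+1)%:R)%:E.
have [G PG] : {G & forall k, P k (G k)}.
  apply: (@choice _ _ P) => k; rewrite /P.
  have e0 : (0 < e%:num / (2 ^ k.+1)%:R)%R by [].
  have : lebesgue_outer (A k) \is a fin_num.
    by rewrite ge0_fin_numE// ltey; apply/eqP.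
  move=> /(lb_ereal_inf_adherent e0)[_ [D [F [AD ->]]] /ltW lt].
  by exists (D, F).
pose J k := (G k).1.
pose a (k j : nat) : \bar R := (box_volume ((G k).2 j))%:E.
have a0 k j : 0 <= a k j by rewrite lee_fin box_volume_ge0.
have /card_esym/ppcard_eqP[f] := card_nat2.
apply: (@le_trans _ _ (\esum_(p in [set: nat] `*`` J) a p.1 p.2)).
  apply: ereal_inf_lbound; exists (f @^-1` ([set: nat] `*`` J)).
  exists (fun k => (G (f k).1).2 (f k).2); split.
    move=> x [k _ /(PG k).1 [j Jj xj]].
    exists (f^-1%FUN (k, j)); rewrite /= invK ?inE//.
  rewrite (reindex_esum (f @^-1` ([set: nat] `*`` J)) _ f)//.
  split=> //; first by move=> i j _ _ /inj; apply; rewrite inE.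
  by move=> p Jp; exists (f^-1%FUN p); rewrite /= invK ?inE.
rewrite -esum_esum; last by move=> *; exact: a0.
rewrite -nneseries_esumT; last by move=> k; apply: esum_ge0 => j _; exact: a0.
apply: lee_nneseries => k *; last exact: (PG k).2.
by apply: esum_ge0 => j _; exact: a0.
Qed.

HB.instance Definition _ := isOuterMeasure.Build R 'rV[R]_n
  (@lebesgue_outer R n) lo0 lo_ge0 lo_le lo_sigma.

End lebesgue_outer_measure.

Definition lebesgue_outer_measure (R : realType) (n : nat) :
    {outer_measure set 'rV[R]_n -> \bar R} :=
  @lebesgue_outer R n.

(* R^n with the sigma-algebra of Lebesgue (Caratheodory) measurable sets. *)
Notation lebesgue_type R n := (caratheodory_type (lebesgue_outer_measure R n)).

Definition lebesgue (R : realType) (n : nat) :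
    {measure set (lebesgue_type R n) -> \bar R} :=
  lebesgue_outer_measure R n.

Notation cfun R n := ('rV[R]_n -> R[i]).

Definition cmod {R : realType} (z : R[i]) : R := ComplexField.Normc.normc z.

Definition ae_equal {R : realType} {n : nat} (f g : cfun R n) : Prop :=
  {ae lebesgue R n, forall x, f x = g x}.

Definition L1loc {R : realType} {n : nat} (f : cfun R n) : Prop :=
  [/\ measurable_fun [set: lebesgue_type R n] (fun x => complex.Re (f x)),
      measurable_fun [set: lebesgue_type R n] (fun x => complex.Im (f x)) &
      forall K : set 'rV[R]_n, compact K ->
        (\int[lebesgue R n]_(x in K) (cmod (f x))%:E < +oo)%E].

Definition cintegral {R : realType} {n : nat} (f : cfun R n) : R[i] :=
  Complex (\int[lebesgue R n]_x complex.Re (f x))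
          (\int[lebesgue R n]_x complex.Im (f x)).

Definition ccontinuous {R : realType} {n : nat} (f : cfun R n) : Prop :=
  continuous (fun x => complex.Re (f x)) /\
  continuous (fun x => complex.Im (f x)).

Definition Cc {R : realType} {n : nat} (f : cfun R n) : Prop :=
  ccontinuous f /\ compact (closure [set x | f x != 0]).

Definition convolution {R : realType} {n : nat} (f g : cfun R n) : cfun R n :=
  fun x => cintegral (fun y => f y * g (x - y)).

Definition translate {R : realType} {n : nat} (x : 'rV[R]_n) (f : cfun R n) :
    cfun R n :=
  fun t => f (t - x).

(* The elements of the space are the almost-everywhere classes of the functions
   in [tibf_set]; [tibf_norm] is irrelevant outside [tibf_set]. Continuity of
   the inclusion into the Frechet space L^1_loc is expressed with the defining
   seminorms, the integrals of the modulus over compact sets. *)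
Record tibf (R : realType) (n : nat) := Tibf {
  tibf_set : set (cfun R n) ;
  tibf_norm : cfun R n -> R ;
  tibf_ae : forall f g, tibf_set f -> ae_equal f g ->
    tibf_set g /\ tibf_norm g = tibf_norm f ;
  tibf_set0 : tibf_set (fun=> 0) ;
  tibf_setD : forall f g, tibf_set f -> tibf_set g ->
    tibf_set (fun x => f x + g x) ;
  tibf_setZ : forall (c : R[i]) f, tibf_set f -> tibf_set (fun x => c * f x) ;
  tibf_norm_ge0 : forall f, tibf_set f -> 0 <= tibf_norm f ;
  tibf_normD : forall f g, tibf_set f -> tibf_set g ->
    tibf_norm (fun x => f x + g x) <= tibf_norm f + tibf_norm g ;
  tibf_normZ : forall (c : R[i]) f, tibf_set f ->
    tibf_norm (fun x => c * f x) = cmod c * tibf_norm f ;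
  tibf_norm_eq0 : forall f, tibf_set f -> tibf_norm f = 0 ->
    ae_equal f (fun=> 0) ;
  tibf_complete : forall u : nat -> cfun R n, (forall k, tibf_set (u k)) ->
    (forall e : R, 0 < e -> exists N : nat, forall j k : nat,
      (N <= j)%N -> (N <= k)%N -> tibf_norm (fun x => u j x - u k x) < e) ->
    exists2 f, tibf_set f &
      (fun k => tibf_norm (fun x => u k x - f x)) @ \oo --> (0 : R) ;
  tibf_neq0 : exists2 f, tibf_set f & ~ ae_equal f (fun=> 0) ;
  tibf_L1loc : tibf_set `<=` L1loc ;
  tibf_L1loc_continuous : forall K : set 'rV[R]_n, compact K ->
    exists2 C : R, 0 < C & forall f, tibf_set f ->
      (\int[lebesgue R n]_(x in K) (cmod (f x))%:E <= (C * tibf_norm f)%:E)%E ;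
  tibf_translate : forall x f, tibf_set f -> tibf_set (translate x f) ;
  tibf_bounded : exists2 C0 : R, 0 < C0 & forall x f, tibf_set f ->
    tibf_norm (translate x f) <= C0 * tibf_norm f ;
  tibf_convolution : forall f g, tibf_set f -> Cc g ->
    tibf_set (convolution f g)
}.

Definition solid {R : realType} {n : nat} (E : tibf R n) : Prop :=
  forall f g : cfun R n, tibf_set E f -> L1loc g ->
    {ae lebesgue R n, forall x, cmod (g x) <= cmod (f x)} ->
    tibf_set E g /\ tibf_norm E g <= tibf_norm E f.

(* The two readings of the bracket [.], namely (.) and {.}. *)
Variant bracket := Beurling | Roumieu.

Definition weight_function {R : realType} {n : nat} (w : 'rV[R]_n -> R) :
    Prop :=
  continuous w /\ forall x, 1 <= w x.

Definition weight_function_system {R : realType} {n : nat}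
    (W : {posnum R} -> 'rV[R]_n -> R) : Prop :=
  (forall l, weight_function (W l)) /\
  forall l m : {posnum R}, m%:num <= l%:num -> forall x, W l x <= W m x.

(* The norm of the library on ['rV[R]_n] is the maximum norm. *)
Definition enorm {R : realType} {n : nat} (x : 'rV[R]_n) : R :=
  Num.sqrt (\sum_(i < n) x 0 i ^+ 2).

Definition wM_bound {R : realType} {n : nat} (v w : 'rV[R]_n -> R) : Prop :=
  exists2 C : R, 0 < C &
    forall x y : 'rV[R]_n, enorm y < 1 -> v (x + y) <= C * w x.

Definition cond_wM {R : realType} {n : nat} (c : bracket)
    (W : {posnum R} -> 'rV[R]_n -> R) : Prop :=
  match c with
  | Beurling => forall l, exists m, wM_bound (W l) (W m)
  | Roumieu => forall m, exists l, wM_bound (W l) (W m)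
  end.

Notation multi n := {ffun 'I_n -> nat}.

Definition mdeg {n : nat} (a : multi n) : nat := (\sum_(i < n) a i)%N.

Definition weight_sequence {R : realType} {n : nat} (M : multi n -> R) : Prop :=
  [/\ forall a, 0 < M a,
      M 0 = 1 &
      forall A : R, exists k : nat, forall a : multi n, (k <= mdeg a)%N ->
        A <= M a `^ (mdeg a)%:R^-1].

Definition log_convex_sequence {R : realType} {n : nat} (M : multi n -> R) :
    Prop :=
  exists F : 'rV[R]_n -> R,
    @convex_function R 'rV[R]_n [set x | forall i, 0 <= (x : 'rV[R]_n) 0 i] F /\
    forall a : multi n, F (\row_i (a i)%:R) = ln (M a).

Definition weight_sequence_system {R : realType} {n : nat}
    (M : {posnum R} -> multi n -> R) : Prop :=
  (forall l, weight_sequence (M l)) /\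
  forall l m : {posnum R}, l%:num <= m%:num -> forall a, M l a <= M m a.

Definition log_convex {R : realType} {n : nat}
    (M : {posnum R} -> multi n -> R) : Prop :=
  forall l, log_convex_sequence (M l).

Definition L_bound {R : realType} {n : nat} (r : R) (Mm Ml : multi n -> R) :
    Prop :=
  exists2 C : R, 0 < C & forall a, r ^+ mdeg a * Mm a <= C * Ml a.

Definition cond_L {R : realType} {n : nat} (c : bracket)
    (M : {posnum R} -> multi n -> R) : Prop :=
  match c with
  | Beurling => forall r : R, 0 < r ->
      forall l, exists m, L_bound r (M m) (M l)
  | Roumieu => forall r : R, 0 < r ->
      forall m, exists l, L_bound r (M m) (M l)
  end.

Definition wI_bound {R : realType} {n : nat} (Mm Ml : multi n -> R) : Prop :=
  exists2 H : R, 0 < H & forall r : R, 0 < r -> exists2 C : R, 0 < C &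
    forall a b : multi n,
      Mm a * r ^+ mdeg b <= C * H ^+ mdeg (a + b) * Ml (a + b).

Definition cond_wI {R : realType} {n : nat} (c : bracket)
    (M : {posnum R} -> multi n -> R) : Prop :=
  match c with
  | Beurling => forall l, exists m, wI_bound (M m) (M l)
  | Roumieu => forall m, exists l, wI_bound (M m) (M l)
  end.

Definition I_bound {R : realType} {n : nat} (Mm Mk Ml : multi n -> R) : Prop :=
  exists C H : R, [/\ 0 < C, 0 < H &
    forall a b : multi n,
      Mm a * Mk b <= C * H ^+ mdeg (a + b) * Ml (a + b)].

Definition cond_I {R : realType} {n : nat} (c : bracket)
    (M : {posnum R} -> multi n -> R) : Prop :=
  match c with
  | Beurling => forall l, exists m k, I_bound (M m) (M k) (M l)
  | Roumieu => forall m k, exists l, I_bound (M m) (M k) (M l)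
  end.

Definition sequence_bound {R : realType} {n : nat} (Mm Nl : multi n -> R) :
    Prop :=
  exists2 C : R, 0 < C & forall a, Mm a <= C * Nl a.

Definition system_sub {R : realType} {n : nat} (c : bracket)
    (M N : {posnum R} -> multi n -> R) : Prop :=
  match c with
  | Beurling => forall l, exists m, sequence_bound (M m) (N l)
  | Roumieu => forall m, exists l, sequence_bound (M m) (N l)
  end.

Definition partial {R : realType} {n : nat} (i : 'I_n) (f : 'rV[R]_n -> R) :
    'rV[R]_n -> R :=
  'D_(delta_mx 0 i) f.

Definition partials {R : realType} {n : nat} (s : seq 'I_n)
    (f : 'rV[R]_n -> R) : 'rV[R]_n -> R :=
  foldr partial f s.

Definition smooth {R : realType} {n : nat} (f : 'rV[R]_n -> R) : Prop :=
  forall s : seq 'I_n, continuous (partials s f) /\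
    forall i x, derivable (partials s f) x (delta_mx 0 i).

Definition csmooth {R : realType} {n : nat} (f : cfun R n) : Prop :=
  smooth (fun x => complex.Re (f x)) /\ smooth (fun x => complex.Im (f x)).

(* The order of differentiation is immaterial for smooth functions. *)
Definition multi_seq {n : nat} (a : multi n) : seq 'I_n :=
  flatten [seq nseq (a i) i | i <- enum 'I_n].

Definition mderiv {R : realType} {n : nat} (a : multi n) (f : cfun R n) :
    cfun R n :=
  fun x => Complex (partials (multi_seq a) (fun y => complex.Re (f y)) x)
                   (partials (multi_seq a) (fun y => complex.Im (f y)) x).

Definition weighted {R : realType} {n : nat} (w : 'rV[R]_n -> R)
    (f : cfun R n) : cfun R n :=
  fun x => f x * Complex (w x) 0.

Definition norm_EMw {R : realType} {n : nat} (E : tibf R n) (M : multi n -> R)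
    (w : 'rV[R]_n -> R) (f : cfun R n) : \bar R :=
  ereal_sup [set (tibf_norm E (weighted w (mderiv a f)) / M a)%:E | a in setT].

Definition space_EMw {R : realType} {n : nat} (E : tibf R n) (M : multi n -> R)
    (w : 'rV[R]_n -> R) : set (cfun R n) :=
  [set f | [/\ csmooth f,
               forall a, tibf_set E (weighted w (mderiv a f)) &
               (norm_EMw E M w f < +oo)%E]].

Definition GS_space {R : realType} {n : nat} (c : bracket) (E : tibf R n)
    (M : {posnum R} -> multi n -> R) (W : {posnum R} -> 'rV[R]_n -> R) :
    set (cfun R n) :=
  match c with
  | Beurling => \bigcap_l space_EMw E (M l) (W l)
  | Roumieu => \bigcup_l space_EMw E (M l) (W l)
  end.

(* Main.v *)
Require Import Defs.
From HB Require Import structures.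
From mathcomp Require Import all_boot all_order all_algebra.
From mathcomp Require Import all_classical all_reals all_analysis.
From mathcomp Require Import measurable_realfun complex ring lra.

Set Implicit Arguments.
Unset Strict Implicit.
Unset Printing Implicit Defensive.

Import Order.TTheory GRing.Theory Num.Theory.
Import numFieldNormedType.Exports.

Local Open Scope classical_set_scope.
Local Open Scope ring_scope.

(** Any element [f0] of the source space can be modulated: by the Leibniz rule,
    the conditions I and L, and solidity of [E], the product of [f0] with a
    superposition of waves [sum_k b k * expi (dot (xi k) x)] stays in the space
    as soon as the numbers [b k * monomial (xi k) s] are summable and bounded by
    a weight sequence of the system ([modulate_space]).

    The derivatives of such products see the frequencies. The derivative of
    order [a] of [f0] modulated at the frequency [s *: x], [0 <= s <= 1], is a
    unimodular function times a polynomial in [s] of degree [d = mdeg a], with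
    coefficients in [E] and leading coefficient [(i x)^a f0]. A finite
    difference with step [1 / d] extracts the leading coefficient, at the cost
    of a factor [2^d d^d / d! <= (2 e)^d]. Hence some [s] satisfies
    [x^a * |f0| <= (2 e)^d * |derivative of order a|], with norms in [E]
    ([modulate_lower_bound]); the condition L absorbs the factor [(2 e)^d].

    Log-convexity provides, for each [a], a frequency [x] with positive
    coordinates such that [x^b / M b <= x^a / M a] for all [b]
    ([log_convex_support]). It comes from an affine minorant of [ln M] that is
    exact at [a]; as [a] may lie on the boundary of the orthant, the slopes are
    found by Farkas' lemma on finitely many lattice points, and the growth of
    [M] takes care of the other points. Modulating at this frequency, with the
    coefficient normalised by [M a / x^a], gives a function which is bounded in
    the space of [M] and whose derivative of order [a] has norm at least of the
    order of [(2 e)^-d * M a].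

    If the inclusion of the systems failed, then [M] would exceed any multiple
    of [N], and a gliding hump argument would add up such functions into a
    single element of the source space that violates all the bounds of the
    target space ([gliding_hump]). The sum is again [f0] times a superposition
    of waves, hence an element of the source space. The step that adds a hump
    only relies on the fact that one of [u] and [u + v] is large when [v] is
    large; in particular the partial sum [u] need not satisfy the bound that is
    being violated, which is what makes the argument work for the inductive
    limit as well as for the projective limit.

    The norm of [f0] in [E] is positive because a nonempty open set is not null:
    otherwise countably many translates of it would make the whole space null,
    and [E] would be trivial ([tibf_norm_gt0]). *)

(** * Affine minorants of log-convex sequences *)

Section Farkas.
Context (R : realType) (n : nat).
Implicit Types (rows : seq ('rV[R]_n * R)) (t a : 'rV[R]_n).

Definition dot t a : R := \sum_i t 0 i * a 0 i.

Lemma dotDr t a b : dot t (a + b) = dot t a + dot t b.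
Proof. by rewrite /dot -big_split; apply: eq_bigr => i _; rewrite mxE mulrDr. Qed.

Lemma dotZr t c a : dot t (c *: a) = c * dot t a.
Proof. by rewrite /dot mulr_sumr; apply: eq_bigr => i _; rewrite mxE mulrCA. Qed.

Lemma dotDl t u a : dot (t + u) a = dot t a + dot u a.
Proof. by rewrite /dot -big_split; apply: eq_bigr => i _; rewrite mxE mulrDl. Qed.

Lemma dot_delta s i a : dot (s *: delta_mx 0 i) a = s * a 0 i.
Proof.
rewrite /dot (bigD1 i)//= !mxE !eqxx mulr1 big1 ?addr0// => j ji.
by rewrite !mxE (negPf ji) andbF mulr0 mul0r.
Qed.

Lemma dotr_delta t i : dot t (delta_mx 0 i) = t 0 i.
Proof.
rewrite /dot (bigD1 i)//= !mxE !eqxx mulr1 big1 ?addr0// => j ji.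
by rewrite !mxE (negPf ji) andbF mulr0.
Qed.

Inductive cone (P : 'rV[R]_n * R -> Prop) : 'rV[R]_n -> R -> Prop :=
| cone_gen r : P r -> cone P r.1 r.2
| cone_comb c d a b x y : 0 <= c -> 0 <= d -> cone P a x -> cone P b y ->
    cone P (c *: a + d *: b) (c * x + d * y).

Lemma cone_trans (P Q : 'rV[R]_n * R -> Prop) a x :
  (forall r, P r -> cone Q r.1 r.2) -> cone P a x -> cone Q a x.
Proof. by move=> PQ; elim=> [r /PQ //|*]; exact: cone_comb. Qed.

Lemma separating_number (L U : seq R) :
  (forall l u, l \in L -> u \in U -> l <= u) ->
  exists s, (forall l, l \in L -> l <= s) /\ (forall u, u \in U -> s <= u).
Proof.
elim: L => [_|l L IH LU].
  elim: U => [|u U [s [_ sU]]]; first by exists 0.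
  exists (Num.min u s); split=> // v; rewrite inE => /orP[/eqP->|/sU sv].
    by rewrite ge_min lexx.
  by rewrite ge_min sv orbT.
have [l' u l'L uU|s [Ls sU]] := IH; first by apply: LU; rewrite // inE l'L orbT.
exists (Num.max l s); split=> [v|u uU].
  by rewrite inE => /orP[/eqP->|/Ls vs]; rewrite le_max ?lexx// vs orbT.
by rewrite ge_max sU// andbT LU// mem_head.
Qed.

(** Fourier-Motzkin elimination: the rows whose coordinate of index [k] is
    positive and those where it is negative are combined pairwise so that this
    coordinate cancels. *)
Lemma farkas rows :
  (exists t, forall r, r \in rows -> dot t r.1 <= r.2) \/
  (exists2 b : R, b < 0 & cone (fun r => r \in rows) 0 b).
Proof.
suff: forall k rows, (forall r, r \in rows -> forall i : 'I_n, (k <= i)%N ->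
      r.1 0 i = 0) ->
    (exists t, forall r, r \in rows -> dot t r.1 <= r.2) \/
    (exists2 b : R, b < 0 & cone (fun r => r \in rows) 0 b).
  by move=> /(_ n rows); apply=> r _ i; rewrite leqNgt ltn_ord.
move=> {rows}; elim=> [|k IH] rows rows0.
  have r0 r : r \in rows -> r.1 = 0.
    by move=> /rows0 r0; apply/rowP => i; rewrite mxE r0.
  have [/allP pos|] := boolP (all (fun r => 0 <= r.2) rows).
    left; exists 0 => r rr; rewrite (r0 _ rr) (le_trans _ (pos _ rr))//.
    by rewrite /dot big1// => i _; rewrite !mxE mulr0.
  move=> /allPn[r rr]; rewrite -ltNge => r2; right; exists r.2 => //.
  by rewrite -(r0 _ rr); exact: cone_gen.
have [kn|nk] := ltnP k n; last first.
  by apply: IH => r _ i ki; move: (ltn_ord i); rewrite ltnNge (leq_trans nk).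
pose i0 := Ordinal kn.
pose pos := [seq r : 'rV[R]_n * R <- rows | 0 < r.1 0 i0].
pose neg := [seq r : 'rV[R]_n * R <- rows | r.1 0 i0 < 0].
pose zer := [seq r : 'rV[R]_n * R <- rows | r.1 0 i0 == 0].
pose comb (p q : 'rV[R]_n * R) := ((- q.1 0 i0) *: p.1 + p.1 0 i0 *: q.1,
  (- q.1 0 i0) * p.2 + p.1 0 i0 * q.2).
pose new := zer ++ [seq comb p q | p <- pos, q <- neg].
have [|[t tnew]|[b b0 cb]] := IH new.
- move=> r; rewrite mem_cat => /orP[rz|/allpairsP[[p q]/= [pp qq ->]]] i ki.
    move: rz; rewrite /zer mem_filter => /andP[/eqP r0 rr].
    have [ik|ik] := eqVneq (i : nat) k; first by rewrite (_ : i = i0)//; exact/val_inj.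
    by apply: (rows0 _ rr); rewrite ltn_neqAle ki andbT eq_sym.
  have [ik|ik] := eqVneq (i : nat) k.
    by rewrite (_ : i = i0) ?mxE; [ring|exact/val_inj].
  move: pp qq; rewrite /pos /neg !mem_filter => /andP[_ pr] /andP[_ qr].
  have ki' : (k < i)%N by rewrite ltn_neqAle ki andbT eq_sym.
  by rewrite !mxE (rows0 p pr i ki') (rows0 q qr i ki') !mulr0 addr0.
- left.
  pose bound (r : 'rV[R]_n * R) := (r.2 - dot t r.1) / r.1 0 i0.
  have [l u|s [negs spos]] := @separating_number (map bound neg) (map bound pos).
    move=> /mapP[q qneg ->] /mapP[p ppos ->].
    have : comb p q \in new.
      by rewrite mem_cat; apply/orP; right; apply/allpairsP; exists (p, q).
    move=> /tnew; rewrite /comb /= dotDr !dotZr /bound.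
    move: qneg ppos; rewrite /pos /neg !mem_filter => /andP[q0 _] /andP[p0 _] H.
    rewrite -subr_ge0.
    have -> : (p.2 - dot t p.1) / p.1 0 i0 - (q.2 - dot t q.1) / q.1 0 i0 =
       ((- q.1 0 i0) * (p.2 - dot t p.1) + p.1 0 i0 * (q.2 - dot t q.1)) /
       (p.1 0 i0 * (- q.1 0 i0)).
      by field; rewrite ?(lt0r_neq0 p0)// ?oppr_eq0 ?(ltr0_neq0 q0).
    by apply: divr_ge0; [nra|rewrite mulr_ge0// ?oppr_ge0 ltW].
  exists (t + s *: delta_mx 0 i0) => r rr; rewrite dotDl dot_delta.
  have [r0|r0|r0] := ltgtP (r.1 0 i0) 0.
  + have /negs : bound r \in map bound neg by rewrite map_f// /pos /neg mem_filter r0.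
    by rewrite /bound ler_ndivrMr//; lra.
  + have /spos : bound r \in map bound pos by rewrite map_f// /pos /neg mem_filter r0.
    by rewrite /bound ler_pdivlMr//; lra.
  + rewrite r0 mulr0 addr0 tnew// mem_cat; apply/orP; left.
    by rewrite /zer mem_filter r0 eqxx.
- right; exists b => //; apply: cone_trans cb => r; rewrite mem_cat.
  move=> /orP[|/allpairsP[[p q]/= [pp qq ->]]].
    by rewrite /zer mem_filter => /andP[_ rr]; exact: cone_gen.
  move: pp qq; rewrite /pos /neg !mem_filter => /andP[p0 pr] /andP[q0 qr].
  by apply: cone_comb; rewrite ?oppr_ge0 ?(ltW p0) ?(ltW q0)//; exact: cone_gen.
Qed.

End Farkas.

Section Support.
Context (R : realType) (n : nat).
Implicit Types (M : multi n -> R) (a b : multi n).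

Definition rowm a : 'rV[R]_n := \row_i (a i)%:R.

Lemma convex_function_ineq (D : set 'rV[R]_n) (F : 'rV[R]_n -> R) (c d : R) x y :
  @convex_function R 'rV[R]_n D F -> D x -> D y -> 0 <= c -> 0 <= d ->
  c + d = 1 -> F (c *: x + d *: y) <= c * F x + d * F y.
Proof.
move=> cF Dx Dy c0 d0 cd.
have c1 : c <= 1 by rewrite -cd lerDl.
have := cF (Itv01 c0 c1) x y; rewrite !inE => /(_ Dx Dy).
by have -> : d = 1 - c by lra.
Qed.

Lemma weight_sequence_growth M : weight_sequence M -> forall r : R, 0 < r ->
  exists k : nat, forall a, (k <= mdeg a)%N -> r ^+ mdeg a <= M a.
Proof.
move=> [M0 _ Moo] r r0; have [k Mk] := Moo r.
exists k.+1 => a ka; have a0 : (0 < mdeg a)%N by exact: leq_ltn_trans ka.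
have := Mk a (ltnW ka); move/(lerXn2r (mdeg a)); rewrite !nnegrE powR_ge0 ltW//.
move=> /(_ isT isT)/le_trans; apply.
have an0 : (mdeg a)%:R != 0 :> R by rewrite pnatr_eq0 -lt0n.
by rewrite -powR_mulrn ?powR_ge0// -powRrM mulVf// powRr1// ltW.
Qed.

(** A conical combination of differences [(b - a, F b - F a)] is a multiple of a
    single difference quotient at a point of the orthant, so that convexity of
    [F] bounds its last component from below. *)
Lemma cone_convex (F : 'rV[R]_n -> R) (x0 : 'rV[R]_n)
    (P : 'rV[R]_n * R -> Prop) (D := [set x : 'rV[R]_n | forall i, 0 <= x 0 i]) :
  @convex_function R 'rV[R]_n D F -> D x0 ->
  (forall r, P r -> exists2 x, D x & r = (x - x0, F x - F x0)) ->
  forall v y, cone P v y -> exists c x,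
    [/\ 0 <= c, D x, v = c *: (x - x0) & c * (F x - F x0) <= y].
Proof.
move=> cF Dx0 PD v y; elim=> [r /PD[x Dx ->]|].
  by exists 1, x; rewrite scale1r mul1r.
move=> c d {}v w {}y z c0 d0 _ [e [u [e0 Du -> ey]]] _ [f [r [f0 Dr -> fz]]].
have [s0|s0] := eqVneq (c * e + d * f) 0.
  have ce0 : 0 <= c * e by exact: mulr_ge0.
  have df0 : 0 <= d * f by exact: mulr_ge0.
  have ce : c * e = 0 by lra.
  have df : d * f = 0 by lra.
  exists 0, x0; split=> //; first by rewrite !scalerA ce df !scale0r addr0.
  rewrite mul0r; have := ler_wpM2l c0 ey; have := ler_wpM2l d0 fz.
  by rewrite !mulrA ce df; lra.
set s := c * e + d * f in s0.
have s_gt0 : 0 < s by rewrite lt_def s0 addr_ge0// mulr_ge0.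
have k0 : 0 <= c * e / s by rewrite !mulr_ge0// invr_ge0 ltW.
have l0 : 0 <= d * f / s by rewrite !mulr_ge0// invr_ge0 ltW.
have kl : c * e / s + d * f / s = 1 by rewrite -mulrDl divff.
exists s, ((c * e / s) *: u + (d * f / s) *: r); split.
- exact: ltW.
- by move=> i; rewrite !mxE addr_ge0// mulr_ge0.
- by apply/rowP => i; rewrite !mxE /s; field.
- have := convex_function_ineq cF Du Dr k0 l0 kl.
  move=> /(ler_wpM2l (ltW s_gt0)).
  rewrite [leRHS](_ : _ = c * e * F u + d * f * F r); last by field.
  move=> Fs.
  have := ler_wpM2l c0 ey; have := ler_wpM2l d0 fz.
  by move: Fs; rewrite /s; lra.
Qed.

Lemma mdeg_delta a (i : 'I_n) : (a i <= mdeg a)%N.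
Proof. by rewrite /mdeg (bigD1 i)//= leq_addr. Qed.

(** The finitely many indices of degree at most [k] admit an affine minorant by
    Farkas. Its slopes are bounded by a constant [A] that only depends on the
    neighbours of [a], except possibly from below in those directions where [a]
    is on the boundary of the orthant; so it is a minorant at the indices of
    large degree as well, since there [ln (M b)] beats any multiple of the
    degree of [b]. *)
Lemma log_convex_subgradient M : weight_sequence M -> log_convex_sequence M ->
  forall a, exists t, forall b, dot t (rowm b - rowm a) <= ln (M b) - ln (M a).
Proof.
move=> wsM [F [cF FM]] a.
have [M0 _ _] := wsM.
pose up (i : 'I_n) : multi n := [ffun j => (a j + (j == i))%N].
pose down (i : 'I_n) : multi n := [ffun j => (a j - (j == i))%N].
pose A := \sum_i (`|ln (M (up i)) - ln (M a)| + `|ln (M (down i)) - ln (M a)|).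
have A0 : 0 <= A by apply: sumr_ge0 => i _; rewrite addr_ge0.
have upA i : ln (M (up i)) - ln (M a) <= A.
  rewrite (le_trans (ler_norm _))// /A (bigD1 i)//= -addrA lerDl addr_ge0//.
  by apply: sumr_ge0 => j _; rewrite addr_ge0.
have downA i : ln (M (down i)) - ln (M a) <= A.
  rewrite (le_trans (ler_norm _))// /A (bigD1 i)//= addrAC lerDr addr_ge0//.
  by apply: sumr_ge0 => j _; rewrite addr_ge0.
pose K := A + (A * (mdeg a)%:R + `|ln (M a)|).
have [k Mk] := weight_sequence_growth wsM (expR_gt0 K).
pose m := (k + (mdeg a).+2)%N.
pose dif b := (rowm b - rowm a, ln (M b) - ln (M a)).
pose rows := [seq dif [ffun i => nat_of_ord (g i)] | g : {ffun 'I_n -> 'I_m}].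
have rowsP b : (mdeg b < m)%N -> dif b \in rows.
  move=> bm; have bi i : (b i < m)%N by exact: leq_ltn_trans (mdeg_delta b i) bm.
  apply/mapP; exists [ffun i => Ordinal (bi i)]; first by rewrite mem_enum.
  by congr dif; apply/ffunP => i; rewrite !ffunE.
have [[t trows]|[y y0 cy]] := farkas rows; last first.
  have D0 b i : 0 <= rowm b 0 i by rewrite mxE.
  have [r|c [x [c0 Dx cx cFy]]] := cone_convex cF (D0 a) _ cy.
    move=> /mapP[g _ ->]; exists (rowm [ffun i => nat_of_ord (g i)]).
      exact: D0.
    by rewrite /dif -!FM.
  exfalso; have [c00|c00] := eqVneq c 0.
    by move: cFy; rewrite c00 mul0r leNgt y0.
  have xa : x = rowm a.
    move/eqP: cx; rewrite eq_sym scaler_eq0 (negPf c00)/= subr_eq0.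
    by move/eqP.
  by move: cFy; rewrite xa subrr mulr0 leNgt y0.
have mdegup i : mdeg (up i) = (mdeg a).+1.
  rewrite /mdeg (eq_bigr (fun j => (a j + (j == i))%N)); last first.
    by move=> j _; rewrite ffunE.
  rewrite big_split/= [X in (_ + X)%N](_ : _ = 1%N) ?addn1//.
  by rewrite (bigD1 i)//= eqxx big1// => j /negPf->.
have mdegdown i : (mdeg (down i) <= mdeg a)%N.
  by apply: leq_sum => j _; rewrite ffunE leq_subr.
have tup i : t 0 i <= A.
  have bm : (mdeg (up i) < m)%N by rewrite mdegup /m addnS ltnS leq_addl.
  have /= H := trows _ (rowsP _ bm).
  apply: le_trans (upA i); apply: le_trans H.
  rewrite (_ : rowm (up i) - rowm a = delta_mx 0 i) ?dotr_delta//.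
  apply/rowP => j; rewrite !mxE !ffunE eqxx/= natrD eq_sym; ring.
have tdown i : (0 < a i)%N -> - A <= t 0 i.
  move=> ai; have bm : (mdeg (down i) < m)%N.
    rewrite (leq_ltn_trans (mdegdown i))// /m addnS ltnS.
    by rewrite (leq_trans (leqnSn _)) ?leq_addl.
  have /= H := trows _ (rowsP _ bm).
  rewrite lerNl; apply: le_trans (downA i); apply: le_trans H.
  rewrite (_ : rowm (down i) - rowm a = (-1) *: delta_mx 0 i).
    by rewrite dotZr dotr_delta mulN1r.
  apply/rowP => j; rewrite !mxE !ffunE eqxx/=.
  have [->|ji] := eqVneq j i; first by rewrite natrB//; ring.
  by rewrite subn0 subrr mulr0.
exists t => b; have [bm|mb] := ltnP (mdeg b) m.
  exact: (trows _ (rowsP _ bm)).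
have dotA : dot t (rowm b - rowm a) <= A * (mdeg b)%:R + A * (mdeg a)%:R.
  rewrite /mdeg !natr_sum -mulrDr -big_split mulr_sumr; apply: ler_sum => i _ /=.
  have b0 : 0 <= (b i)%:R :> R by [].
  have a0 : 0 <= (a i)%:R :> R by [].
  rewrite !mxE; have := tup i.
  have [ab|ba] := leqP (a i) (b i).
    have : (a i)%:R <= (b i)%:R :> R by rewrite ler_nat.
    by nra.
  have : (b i)%:R <= (a i)%:R :> R by rewrite ler_nat ltnW.
  have /tdown : (0 < a i)%N by exact: leq_ltn_trans ba.
  by nra.
apply: (le_trans dotA).
have km : (k <= mdeg b)%N by apply: leq_trans mb; rewrite /m leq_addr.
have lnMb : K * (mdeg b)%:R <= ln (M b).
  have := Mk b km; rewrite -expRM_natr -{1}(lnK (M0 b)) ?posrE// ler_expR.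
  by rewrite mulrC.
have b1 : 1 <= (mdeg b)%:R :> R.
  by rewrite ler1n; apply: leq_trans mb; rewrite /m addnS.
have := ler_norm (ln (M a)); have a0 : 0 <= A * (mdeg a)%:R by exact: mulr_ge0.
have := normr_ge0 (ln (M a)).
by move: lnMb; rewrite /K; nra.
Qed.

End Support.

(** * Monomials indexed by sequences of directions *)

Section Monomials.
Context (R : realType) (n : nat).
Implicit Types (s : seq 'I_n) (x : 'rV[R]_n) (a b : multi n).

Definition monomial x s : R := \prod_(i <- s) x 0 i.

Definition counts s : multi n := [ffun i => count_mem i s].

Lemma monomial_cat x s t : monomial x (s ++ t) = monomial x s * monomial x t.
Proof. exact: big_cat. Qed.

Lemma monomial_cons x i s : monomial x (i :: s) = x 0 i * monomial x s.
Proof. exact: big_cons. Qed.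

Lemma monomial_ge0 x s : (forall i, 0 <= x 0 i) -> 0 <= monomial x s.
Proof. by move=> x0; apply: prodr_ge0. Qed.

Lemma monomial_gt0 x s : (forall i, 0 < x 0 i) -> 0 < monomial x s.
Proof. by move=> x0; apply: prodr_gt0. Qed.

Lemma monomialZ (c : R) x s : monomial (c *: x) s = c ^+ size s * monomial x s.
Proof.
elim: s => [|i s IH]; first by rewrite /monomial !big_nil expr0 mul1r.
by rewrite !monomial_cons IH mxE exprS; ring.
Qed.

Lemma counts_multi_seq a : counts (multi_seq a) = a.
Proof.
apply/ffunP => i; rewrite ffunE count_flatten -map_comp sumnE big_map.
rewrite (bigD1_seq i) ?mem_enum ?enum_uniq//= count_nseq /= eqxx mul1n big1 ?addn0// => j.
by rewrite count_nseq /= => /negPf ->.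
Qed.

Lemma size_counts s : mdeg (counts s) = size s.
Proof.
rewrite /mdeg; under eq_bigr do rewrite ffunE.
elim: s => [|i s IH]/=; first by rewrite big1.
rewrite big_split/= IH -add1n; congr (_ + _)%N.
by rewrite (bigD1 i)//= eqxx big1// => j; rewrite eq_sym => /negPf ->.
Qed.

Lemma size_multi_seq a : size (multi_seq a) = mdeg a.
Proof. by rewrite -size_counts counts_multi_seq. Qed.

Lemma counts_cat s t : counts (s ++ t) = counts s + counts t.
Proof. by apply/ffunP => i; rewrite !ffunE count_cat. Qed.

Lemma eq_counts s t : perm_eq s t -> counts s = counts t.
Proof. by move=> /permP st; apply/ffunP => i; rewrite !ffunE st. Qed.

Definition ord_le : rel 'I_n := fun i j => (i <= j)%N.

Lemma ord_le_trans : transitive ord_le.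
Proof. by move=> j i k; exact: leq_trans. Qed.

Lemma sorted_multi_seq a : sorted ord_le (multi_seq a).
Proof.
have : sorted ord_le (enum 'I_n).
  have -> : ord_le = relpre val leq by [].
  by rewrite -sorted_map val_enum_ord iota_sorted.
rewrite /multi_seq !(sorted_pairwise ord_le_trans).
elim: (enum _) => [//|i s IH] /= /andP[ai ps].
rewrite pairwise_cat IH// andbT; apply/andP; split.
  apply/allrelP => j k; rewrite mem_nseq => /andP[_ /eqP ->].
  move=> /flattenP[t /mapP[l ls ->]]; rewrite mem_nseq => /andP[_ /eqP ->].
  exact: (allP ai).
by elim: (a i) => //= m ->; rewrite andbT all_nseq /ord_le leqnn orbT.
Qed.

(** Partial derivatives are taken along sequences of directions; the sequences
    that come from multi-indices are the sorted ones. *)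
Lemma sorted_multiE s : sorted ord_le s -> multi_seq (counts s) = s.
Proof.
move=> ss; apply: (sorted_eq ord_le_trans) => //.
- by move=> i j ij; apply/val_inj/eqP; rewrite eqn_leq.
- exact: sorted_multi_seq.
apply/permP => p; rewrite -!sum1_count.
have E (u : seq 'I_n) : (\sum_(j <- u | p j) 1 = \sum_(i | p i) count_mem i u)%N.
  transitivity (\sum_(i | p i) \sum_(j <- u | j == i) 1)%N; last first.
    by apply: eq_bigr => i _; rewrite sum1_count.
  rewrite (exchange_big_dep xpredT)//= [LHS]big_mkcond; apply: eq_bigr => j _.
  rewrite big_mkcondr/=.
  have [pj|pj] := boolP (p j).
    by rewrite (bigD1 j)//= eqxx big1// => i /andP[_ ij]; rewrite eq_sym (negPf ij).
  by rewrite big1// => i pi; case: eqP => // ij; rewrite ij pi in pj.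
rewrite !E; apply: eq_bigr => i _.
by have /ffunP/(_ i) := counts_multi_seq (counts s); rewrite !ffunE.
Qed.

(** The superexponential growth of [M] leaves only finitely many exponents, over
    which the constant is the sum of the inverses of [M]. *)
Lemma weight_sequence_dominates (M : multi n -> R) : weight_sequence M ->
  forall x, exists2 C, 0 < C & forall s, `|monomial x s| <= C * M (counts s).
Proof.
move=> wsM x; have [M0 _ _] := wsM.
pose r := 1 + \sum_i `|x 0 i|.
have r1 : 1 <= r by rewrite lerDl sumr_ge0.
have r0 : 0 < r by exact: lt_le_trans r1.
have xr s : `|monomial x s| <= r ^+ size s.
  elim: s => [|i s IH]; first by rewrite /monomial big_nil normr1.
  rewrite monomial_cons normrM exprS ler_pM// /r (bigD1 i)//= addrCA lerDl.
  by rewrite addr_ge0// sumr_ge0.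
have [k Mk] := weight_sequence_growth wsM r0.
pose C := \sum_(g : {ffun 'I_n -> 'I_k}) (M [ffun i => nat_of_ord (g i)])^-1.
have C0 : 0 <= C by apply: sumr_ge0 => g _; rewrite invr_ge0 ltW.
exists (1 + r ^+ k * C) => [|s]; first by rewrite ltr_pwDl// mulr_ge0// exprn_ge0// ltW.
apply: le_trans (xr s) _; have [sk|ks] := ltnP (size s) k; last first.
  have := Mk (counts s); rewrite size_counts => /(_ ks)/le_trans; apply.
  by rewrite ler_peMl ?(ltW (M0 _))// lerDl mulr_ge0// exprn_ge0// ltW.
have ck i : (counts s i < k)%N.
  by rewrite (leq_ltn_trans _ sk)// -size_counts mdeg_delta.
have MC : 1 <= C * M (counts s).
  rewrite -ler_pdivrMr// mul1r /C (bigD1 [ffun i => Ordinal (ck i)])//=.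
  have -> : [ffun i => nat_of_ord ([ffun i => Ordinal (ck i)] i)] = counts s.
    by apply/ffunP => i; rewrite !ffunE/= ?ffunE.
  by rewrite lerDl sumr_ge0// => g _; rewrite invr_ge0 ltW.
rewrite mulrDl mul1r -mulrA.
have rk : r ^+ size s <= r ^+ k by rewrite ler_weXn2l// ltnW.
have rk0 : 0 <= r ^+ k by rewrite exprn_ge0// ltW.
have := M0 (counts s); nra.
Qed.

(** The subgradient is exponentiated: log-convex sequences are those that can
    be recovered from the growth of their associated functions. *)
Lemma log_convex_support (M : multi n -> R) : weight_sequence M ->
  log_convex_sequence M -> forall a, exists2 x : 'rV[R]_n, forall i, 0 < x 0 i &
  forall s, monomial x s * M a <= monomial x (multi_seq a) * M (counts s).
Proof.
move=> wsM lcM a; have [t tM] := log_convex_subgradient wsM lcM a.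
have [M0 _ _] := wsM.
exists (\row_i expR (t 0 i)) => [i|s]; first by rewrite mxE expR_gt0.
have E u : monomial (\row_i expR (t 0 i)) u = expR (dot t (rowm R (counts u))).
  elim: u => [|i u IH].
    rewrite /monomial big_nil /dot big1 ?expR0// => i _.
    by rewrite mxE ffunE/= mulr0.
  rewrite monomial_cons IH mxE -expRD; congr expR.
  have -> : rowm R (counts (i :: u)) = delta_mx 0 i + rowm R (counts u).
    apply/rowP => j; rewrite !mxE !ffunE/= natrD; congr (_ + _).
    by rewrite ?eqxx/= eq_sym.
  by rewrite dotDr dotr_delta.
have := tM (counts s); rewrite !E counts_multi_seq.
have -> : rowm R (counts s) - rowm R a = rowm R (counts s) + (-1) *: rowm R a.
  by rewrite scaleN1r.
rewrite dotDr dotZr mulN1r -[in X in _ * X <= _](lnK (M0 a)).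
rewrite -[in X in _ <= _ * X](lnK (M0 (counts s))).
by rewrite -!expRD ler_expR; lra.
Qed.

End Monomials.

(** * Lebesgue measurability and null sets in R^n *)

Section LebesgueRn.
Context (R : realType) (n : nat).
Implicit Types (A U : set 'rV[R]_n) (f : 'rV[R]_n -> R).

Notation mu := (lebesgue_outer_measure R n).
Notation L := (lebesgue_type R n).

Lemma max_sub_split (a b c : R) :
  Num.max 0 (Num.min c b - a) + Num.max 0 (b - Num.max c a) <= Num.max 0 (b - a).
Proof.
have pos (x : R) : 0 <= x -> Num.max 0 x = x by move/max_idPr.
have neg (x : R) : x <= 0 -> Num.max 0 x = 0 by move/max_idPl.
have [ca|/ltW ac] := leP c a.
  by rewrite neg ?add0r// subr_le0 ge_min ca.
have [bc|/ltW cb] := leP b c; first by rewrite [X in _ + X]neg ?addr0// subr_le0.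
by rewrite !pos ?subr_ge0// ?(le_trans ac)//; lra.
Qed.

(** Clipping a box along a hyperplane splits its volume. *)
Lemma measurable_halfspace (i : 'I_n) (c : R) :
  @measurable _ L [set x : 'rV[R]_n | x 0 i <= c].
Proof.
set H := [set x | _]; apply: le_caratheodory_measurable => X.
apply: le_ereal_inf_tmp => _ [D [F [XF ->]]].
pose lo (ab : 'rV[R]_n * 'rV[R]_n) : 'rV[R]_n * 'rV[R]_n :=
  (ab.1, \row_j if j == i then Num.min c (ab.2 0 j) else ab.2 0 j).
pose hi (ab : 'rV[R]_n * 'rV[R]_n) : 'rV[R]_n * 'rV[R]_n :=
  (\row_j (if j == i then Num.max c (ab.1 0 j) else ab.1 0 j), ab.2).
have vol ab : box_volume (lo ab) + box_volume (hi ab) <= box_volume ab.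
  have vE cd : box_volume cd = Num.max 0 (cd.2 0 i - cd.1 0 i) *
      \prod_(j < n | j != i) Num.max 0 (cd.2 0 j - cd.1 0 j) :> R.
    by rewrite /box_volume (bigD1 i).
  rewrite !vE /= !mxE eqxx.
  have -> : \prod_(j < n | j != i) Num.max 0 ((\row_k (if k == i
              then Num.min c (ab.2 0 k) else ab.2 0 k)) 0 j - ab.1 0 j) =
            \prod_(j < n | j != i) Num.max 0 (ab.2 0 j - ab.1 0 j).
    by apply: eq_bigr => j /negPf ji; rewrite mxE ji.
  have -> : \prod_(j < n | j != i) Num.max 0 (ab.2 0 j - (\row_k (if k == i
              then Num.max c (ab.1 0 k) else ab.1 0 k)) 0 j) =
            \prod_(j < n | j != i) Num.max 0 (ab.2 0 j - ab.1 0 j).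
    by apply: eq_bigr => j /negPf ji; rewrite mxE ji.
  rewrite -mulrDl ler_wpM2r ?max_sub_split//.
  by apply: prodr_ge0 => j _; rewrite le_max lexx.
apply: (@le_trans _ _ (\esum_(k in D) (box_volume (lo (F k)))%:E +
                       \esum_(k in D) (box_volume (hi (F k)))%:E)%E).
  apply: leeD; apply: ereal_inf_lbound.
    exists D, (lo \o F); split=> // x [/XF[k Dk xk] xH]; exists k => //= j.
    by rewrite !mxE; case: eqP => [->|_]; rewrite ?le_min ?xH//; exact: xk.
  exists D, (hi \o F); split=> // x [/XF[k Dk xk]] /negP xH; exists k => //= j.
  rewrite !mxE; case: eqP => [->|_]; last exact: xk.
  by have /andP[ax xb] := xk i; rewrite ge_max ax xb !andbT ltW// ltNge.
rewrite -esumD; last 2 first.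
- by move=> k _; rewrite lee_fin box_volume_ge0.
- by move=> k _; rewrite lee_fin box_volume_ge0.
by apply: le_esum => k _; rewrite -EFinD lee_fin.
Qed.

(** The cells are indexed by a countable set, so that any open set is the
    countable union of the cells it contains. *)
Definition cell (m : nat) (q : 'rV[int]_n) : set 'rV[R]_n :=
  [set x | forall i, (q 0 i)%:~R < x 0 i * m.+1%:R <= (q 0 i)%:~R + 1].

Lemma measurable_cell m q : @measurable _ L (cell m q).
Proof.
have -> : cell m q = \bigcap_(i in [set: 'I_n])
    ([set x : 'rV[R]_n | x 0 i <= ((q 0 i)%:~R + 1) / m.+1%:R] `\`
     [set x : 'rV[R]_n | x 0 i <= (q 0 i)%:~R / m.+1%:R]).
  apply/seteqP; split=> [x xq i _|x xq i].
    have /andP[q1 q2] := xq i; split; first by rewrite /= ler_pdivlMr.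
    by apply/negP; rewrite -ltNge ltr_pdivrMr.
  have [/= q2 /negP] := xq i I; rewrite -ltNge ltr_pdivrMr// => ->/=.
  by rewrite -ler_pdivlMr.
apply: fin_bigcap_measurable => [|i _]; first exact: finite_finset.
by apply: measurableD; exact: measurable_halfspace.
Qed.

Lemma inv_natS_lt (e : R) : 0 < e -> exists m, m.+1%:R^-1 < e.
Proof.
move=> e0; exists (Num.truncn e^-1); rewrite invf_plt ?posrE//.
exact: truncnS_gt.
Qed.

Lemma mem_cell m (x : 'rV[R]_n) : exists q, cell m q x.
Proof.
exists (\row_i (Num.ceil (x 0 i * m.+1%:R) - 1)) => i; rewrite mxE intrB mulr1z.
have := ceil_itv (x 0 i * m.+1%:R).
by rewrite intrB mulr1z subrK.
Qed.

Lemma cell_dist m q (x : 'rV[R]_n) i : cell m q x ->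
  0 < x 0 i - (q 0 i)%:~R / m.+1%:R <= m.+1%:R^-1.
Proof.
move=> /(_ i); have m0 : 0 < m.+1%:R^-1 :> R by rewrite invr_gt0.
move=> /andP[]; rewrite -(ltr_pM2r m0) -(ler_pM2r m0) mulrDl mul1r mulfK//.
by rewrite subr_gt0 lerBlDr [_^-1 + _]addrC => -> ->.
Qed.

Lemma open_measurableRn U : open U -> @measurable _ L U.
Proof.
move=> oU.
pose F (p : nat * 'rV[int]_n) :=
  if `[<cell p.1 p.2 `<=` U>] then cell p.1 p.2 else set0.
have -> : U = \bigcup_p F p.
  apply/seteqP; split=> [x Ux|x [p _]]; rewrite /F; last by case: asboolP => // /[apply].
  have /nbhs_ballP[e/= e0 eU] : nbhs x U by exact: open_nbhs_nbhs.
  have [m me] := inv_natS_lt e0; have [q xq] := mem_cell m x.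
  exists (m, q) => //=; case: asboolP => // -[] y yq; apply: eU; split=> // i j.
  rewrite ord1 /ball/= (le_lt_trans _ me)//.
  by have := cell_dist j xq; have := cell_dist j yq;
    rewrite ler_norml; move: (_^-1) (_ / _) => u v /andP[? ?] /andP[? ?]; lra.
apply: countable_bigcupT_measurable; first exact: countableP.
by move=> p; rewrite /F; case: ifP => _; [exact: measurable_cell|exact: measurable0].
Qed.

Lemma continuous_measurableRn f : continuous f -> measurable_fun [set: L] f.
Proof.
move=> cf; apply: (measurability _ (RGenOInfty.measurableE R)).
move=> _ [_ [a ->] <-]; rewrite setTI; apply: open_measurableRn.
by apply: open_comp => [x _|]; [exact: cf|exact: interval_open].
Qed.

Lemma compact_measurableRn A : compact A -> @measurable _ L A.
Proof.
move=> cA; rewrite -[A]setCK; apply: measurableC; apply: open_measurableRn.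
by apply: closed_openC; apply: compact_closed cA; exact: norm_hausdorff.
Qed.

Lemma negligible_lebesgueE (A : set L) :
  (lebesgue R n).-negligible A <-> mu A = 0%E.
Proof.
split=> [[B [mB B0 AB]]|A0].
  apply/eqP; rewrite eq_le outer_measure_ge0 andbT -B0.
  exact: le_outer_measure.
exists A; split=> //; apply: le_caratheodory_measurable => X.
suff -> : mu (X `&` A) = 0%E by rewrite add0e le_outer_measure.
by apply/eqP; rewrite eq_le outer_measure_ge0 andbT -A0 le_outer_measure.
Qed.

Lemma lebesgue_outer_shift (z : 'rV[R]_n) A :
  (mu [set (x + z)%R | x in A] <= mu A)%E.
Proof.
apply: le_ereal_inf_tmp => _ [D [F [AF ->]]]; apply: ereal_inf_lbound.
exists D, (fun k => ((F k).1 + z, (F k).2 + z)); split.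
  move=> _ [x /AF[k Dk xk] <-]; exists k => // i.
  by rewrite /= !mxE !lerD2r.
apply: eq_esum => k _; congr EFin; apply: eq_bigr => i _; congr Num.max.
by rewrite /= !mxE; ring.
Qed.

(** Countably many translates of a nonempty open set cover the space. *)
Lemma null_open_setT U x : open U -> U x -> mu U = 0%E -> mu setT = 0%E.
Proof.
move=> oU Ux U0.
have /nbhs_ballP[e/= e0 eU] : nbhs x U by exact: open_nbhs_nbhs.
pose z (p : nat * 'rV[int]_n) : 'rV[R]_n := \row_i ((p.2 0 i)%:~R / p.1.+1%:R).
pose T p := [set y + z p | y in U].
pose F k := oapp T set0 (unpickle k).
have F0 k : mu (F k) = 0%E.
  rewrite /F; case: unpickle => [p|]/=; last exact: outer_measure0.
  by apply/eqP; rewrite eq_le outer_measure_ge0 andbT -U0 lebesgue_outer_shift.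
have cov : setT `<=` \bigcup_k F k.
  move=> y _; have [m me] := inv_natS_lt e0; have [q yq] := mem_cell m (y - x).
  exists (pickle (m, q)) => //; rewrite /F pickleK /=.
  exists (y - z (m, q)); last by rewrite subrK.
  apply: eU; split=> // i j; rewrite ord1 /ball /= (le_lt_trans _ me)//.
  have := cell_dist j yq; rewrite !mxE ler_norml.
  by move: (_^-1) (_ / _) => u v /andP[? ?]; lra.
apply/eqP; rewrite eq_le outer_measure_ge0 andbT.
apply: (le_trans (le_outer_measure mu _ _ cov)).
apply: (le_trans (outer_measure_sigma_subadditive mu F)).
by rewrite eseries0// => k _ _; rewrite F0.
Qed.

End LebesgueRn.

(** * Solid function spaces *)

Section ComplexModulus.
Context (R : realType).
Implicit Types z : R[i].

Lemma cmodE z : cmod z = Num.sqrt (complex.Re z ^+ 2 + complex.Im z ^+ 2).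
Proof. by case: z. Qed.

Lemma cmod_ge0 z : 0 <= cmod z.
Proof. by rewrite cmodE sqrtr_ge0. Qed.

Lemma cmod_real (r : R) : cmod (Complex r 0) = `|r|.
Proof. by rewrite cmodE/= expr0n/= addr0 sqrtr_sqr. Qed.

Lemma cmodM z w : cmod (z * w) = cmod z * cmod w.
Proof. exact: ComplexField.Normc.normcM. Qed.

Lemma cmod_le_ReIm z : cmod z <= `|complex.Re z| + `|complex.Im z|.
Proof.
rewrite cmodE; case: z => a b /=.
rewrite -[leRHS]ger0_norm ?addr_ge0// -sqrtr_sqr ler_wsqrtr// sqrrD.
rewrite !real_normK ?num_real// lerD2r lerDl mulrn_wge0// mulr_ge0//.
Qed.

Lemma cmod0 : cmod (0 : R[i]) = 0.
Proof. exact: ComplexField.Normc.normc0. Qed.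

End ComplexModulus.

Section SolidSpace.
Context (R : realType) (n : nat).
Implicit Types (f g h : cfun R n).

Notation L := (lebesgue_type R n).

Definition cmeasurable f :=
  measurable_fun [set: L] (fun x => complex.Re (f x)) /\
  measurable_fun [set: L] (fun x => complex.Im (f x)).

Lemma ccontinuous_measurable f : ccontinuous f -> cmeasurable f.
Proof. by move=> [? ?]; split; exact: continuous_measurableRn. Qed.

Lemma L1loc_measurable f : L1loc f -> cmeasurable f.
Proof. by case. Qed.

Lemma cmeasurableM f g : cmeasurable f -> cmeasurable g ->
  cmeasurable (fun x => f x * g x).
Proof.
move=> [f1 f2] [g1 g2]; split.
  have -> : (fun x => complex.Re (f x * g x)) =
     (fun x => complex.Re (f x) * complex.Re (g x) - complex.Im (f x) * complex.Im (g x)).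
    by apply/funext => x; case: (f x) (g x) => [? ?] [? ?].
  by apply: measurable_funB; exact: measurable_funM.
have -> : (fun x => complex.Im (f x * g x)) =
   (fun x => complex.Re (f x) * complex.Im (g x) + complex.Im (f x) * complex.Re (g x)).
  by apply/funext => x; case: (f x) (g x) => [? ?] [? ?].
by apply: measurable_funD; exact: measurable_funM.
Qed.

Lemma measurable_cmod f : cmeasurable f ->
  measurable_fun [set: L] (fun x => cmod (f x)).
Proof.
move=> [f1 f2].
have -> : (fun x => cmod (f x)) = Num.sqrt \o
    (fun x => complex.Re (f x) ^+ 2 + complex.Im (f x) ^+ 2).
  by apply/funext => x; rewrite /= cmodE.
apply: measurableT_comp.
  by apply: continuous_measurable_fun; exact: sqrt_continuous.
by apply: measurable_funD; exact: measurable_funX.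
Qed.

Lemma L1loc_le f g : L1loc f -> cmeasurable g ->
  (forall x, cmod (g x) <= cmod (f x)) -> L1loc g.
Proof.
move=> Lf mg gf; have mf := L1loc_measurable Lf.
have [_ _ If] := Lf; have [mg1 mg2] := mg; split=> // K cK.
apply: le_lt_trans (If K cK); apply: ge0_le_integral.
- exact: compact_measurableRn.
- by move=> x _; rewrite lee_fin cmod_ge0.
- by apply/measurable_EFinP/measurable_funTS; exact: measurable_cmod.
- by apply/measurable_EFinP/measurable_funTS; exact: measurable_cmod.
- by move=> x _; rewrite lee_fin.
Qed.

Variables (E : tibf R n) (solidE : solid E).

Lemma solid_le f g : tibf_set E f -> cmeasurable g ->
  (forall x, cmod (g x) <= cmod (f x)) ->
  tibf_set E g /\ tibf_norm E g <= tibf_norm E f.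
Proof.
move=> Ef mg gf; apply: solidE => //; last exact: aeW.
exact: L1loc_le (tibf_L1loc Ef) mg gf.
Qed.

Lemma solid_mul (C : R) f g : 0 <= C -> tibf_set E f -> cmeasurable g ->
  (forall x, cmod (g x) <= C) ->
  tibf_set E (fun x => f x * g x) /\
  tibf_norm E (fun x => f x * g x) <= C * tibf_norm E f.
Proof.
move=> C0 Ef mg gC; have ECf := tibf_setZ (Complex C 0) Ef.
have [||Efg] := solid_le (g := fun x => f x * g x) ECf.
- exact: cmeasurableM (L1loc_measurable (tibf_L1loc Ef)) mg.
- move=> x; rewrite !cmodM cmod_real ger0_norm// mulrC.
  by rewrite ler_wpM2r ?cmod_ge0.
by rewrite tibf_normZ// cmod_real ger0_norm.
Qed.

Lemma tibf_norm0 : tibf_norm E (fun=> 0) = 0.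
Proof.
rewrite -[fun=> 0](_ : (fun x : 'rV[R]_n => 0 * (fun=> 0) x) = _) /=.
  by rewrite (tibf_normZ 0 (tibf_set0 E)) cmod0 mul0r.
by apply/funext => x; rewrite mul0r.
Qed.

Lemma tibf_sum (I : eqType) (r : seq I) (F : I -> cfun R n) :
  (forall i, i \in r -> tibf_set E (F i)) ->
  tibf_set E (fun x => \sum_(i <- r) F i x) /\
  tibf_norm E (fun x => \sum_(i <- r) F i x) <= \sum_(i <- r) tibf_norm E (F i).
Proof.
elim: r => [_|i r IH EF].
  rewrite (_ : (fun x => _) = fun=> 0); last by apply/funext => x; rewrite big_nil.
  by rewrite big_nil tibf_norm0; split=> //; exact: tibf_set0.
have [j jr|Es Ns] := IH; first by apply: EF; rewrite inE jr orbT.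
have Ei : tibf_set E (F i) by apply: EF; rewrite mem_head.
rewrite (_ : (fun x => _) = fun x => F i x + \sum_(j <- r) F j x); last first.
  by apply/funext => x; rewrite big_cons.
split; first exact: tibf_setD.
by rewrite big_cons (le_trans (tibf_normD Ei Es))// lerD2l.
Qed.

Lemma tibf_normB f g : tibf_set E f -> tibf_set E g ->
  tibf_norm E (fun x => f x - g x) <= tibf_norm E f + tibf_norm E g.
Proof.
move=> Ef Eg; have Eg' := tibf_setZ (-1) Eg.
have -> : (fun x => f x - g x) = (fun x => f x + (-1) * g x).
  by apply/funext => x; rewrite mulN1r.
apply: le_trans (tibf_normD Ef Eg') _; rewrite tibf_normZ//.
by rewrite cmodE/= oppr0 sqrrN expr1n expr0n/= addr0 sqrtr1 mul1r.
Qed.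

(** If the open set where [f] does not vanish were null, so would be the whole
    space, and all functions would be equal almost everywhere. *)
Lemma tibf_norm_gt0 f x : ccontinuous f -> tibf_set E f -> f x != 0 ->
  0 < tibf_norm E f.
Proof.
move=> [cf1 cf2] Ef fx0; rewrite lt_def tibf_norm_ge0// andbT.
apply/eqP => /(tibf_norm_eq0 Ef)/negligible_lebesgueE f0.
pose m y := `|complex.Re (f y)| + `|complex.Im (f y)|.
have m0 y : (0 < m y) = (f y != 0).
  rewrite /m; case: (f y) => a b /=; rewrite eq_complex/= negb_and.
  rewrite lt_def addr_ge0// andbT paddr_eq0// !normr_eq0 negb_and//.
have cm : continuous m.
  move=> y; apply: (@continuousD _ _ _ (fun y => `|complex.Re (f y)|)
    (fun y => `|complex.Im (f y)|)).
    by apply: (continuous_comp (cf1 y)); exact: norm_continuous.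
  by apply: (continuous_comp (cf2 y)); exact: norm_continuous.
have oU : open [set y | 0 < m y].
  have -> : [set y | 0 < m y] = m @^-1` [set r | 0 < r] by [].
  by apply: open_comp => [y _|]; [exact: cm|exact: open_gt].
have U0 : lebesgue_outer_measure R n [set y | 0 < m y] = 0%E.
  rewrite -f0; congr (_ _); apply/seteqP; split=> y /=.
    by rewrite m0 => /eqP.
  by move=> /eqP; rewrite m0.
have T0 : lebesgue_outer_measure R n setT = 0%E.
  have Ux : [set y | 0 < m y] x by rewrite /= m0.
  exact: null_open_setT oU Ux U0.
have [g _] := tibf_neq0 E; apply; apply/negligible_lebesgueE.
apply/eqP; rewrite eq_le outer_measure_ge0 andbT -T0.
exact: le_outer_measure.
Qed.

End SolidSpace.

(** * Trigonometric series with rapidly decreasing coefficients *)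

Section GeometricSeries.
Context (R : realType).
Implicit Types (u v : nat -> R) (C D : R).

Definition rsum u : R := limn (series u).

Definition geo_bounded u C := forall k, `|u k| <= C * 2^-1 ^+ k.

Let half_lt1 : `|2^-1| < 1 :> R.
Proof. by rewrite ger0_norm// invf_lt1// ltr1n. Qed.

Lemma geo_bounded_normed u C : geo_bounded u C -> cvgn [normed series u].
Proof.
move=> uC; have cg : cvgn (series (geometric C 2^-1)).
  exact: is_cvg_geometric_series.
apply: (series_le_cvg _ _ _ cg) => k; first exact: normr_ge0.
  exact: le_trans (uC k).
exact: uC.
Qed.

Lemma geo_bounded_cvg u C : geo_bounded u C -> cvgn (series u).
Proof. by move=> /geo_bounded_normed; exact: normed_cvg. Qed.

Lemma geo_bounded_rsum u C : geo_bounded u C -> `|rsum u| <= 2 * C.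
Proof.
move=> uC; have cn := geo_bounded_normed uC.
apply: le_trans (lim_series_norm cn) _.
have -> : 2 * C = limn (series (geometric C 2^-1)).
  rewrite (cvg_lim _ (cvg_geometric_series half_lt1))//.
  by rewrite mulrC; congr (_ * _); field.
apply: lim_series_le => //; exact: is_cvg_geometric_series.
Qed.

Lemma rsumB u v C D : geo_bounded u C -> geo_bounded v D ->
  rsum (fun k => u k - v k) = rsum u - rsum v.
Proof.
by move=> /geo_bounded_cvg cu /geo_bounded_cvg cv; exact: lim_seriesB.
Qed.

Lemma rsumZ c u C : geo_bounded u C -> rsum (fun k => c * u k) = c * rsum u.
Proof. by move=> /geo_bounded_cvg cu; exact: lim_seriesZ. Qed.

Lemma rsum_single k c : rsum (fun j => if j == k then c else 0) = c.
Proof.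
apply: lim_near_cst => //; exists k.+1 => // m /= km; rewrite /series/=.
rewrite big_mkord (bigD1 (Ordinal km))//= eqxx big1 ?addr0// => j.
by rewrite -val_eqE/= => /negPf->.
Qed.

End GeometricSeries.

Section CosineLipschitz.
Context (R : realType).
Implicit Types a b h : R.

Lemma cos_lipschitz a b : `|cos b - cos a| <= `|b - a|.
Proof.
wlog ab : a b / a <= b.
  by move=> H; have [/H//|/ltW/H] := leP a b; rewrite distrC [leRHS]distrC.
have [c _ ->] := MVT_segment ab (fun x _ => is_derive_cos x)
  (continuous_subspaceT (@continuous_cos R)).
rewrite normrM normrN ler_piMl// ler_norml.
by rewrite sin_geN1 sin_le1.
Qed.

(** The mean value theorem leaves an increment of the sine, which is bounded
    with the Lipschitz estimate. *)
Lemma cos_taylor1 a h :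
  `|cos (a + h) - cos a - h * cos (a + pi / 2)| <= h ^+ 2.
Proof.
have sin_lip (x y : R) : `|sin y - sin x| <= `|y - x|.
  have E (z : R) : sin z = - cos (z + pi / 2) by rewrite cosDpihalf opprK.
  rewrite !E -opprD normrN (le_trans (cos_lipschitz _ _))//.
  by rewrite opprD addrACA subrr addr0.
suff: exists2 c, `|c - a| <= `|h| & cos (a + h) - cos a = - sin c * h.
  move=> [c ch ->]; rewrite cosDpihalf.
  have -> : - sin c * h - h * - sin a = h * (sin a - sin c) by ring.
  rewrite normrM -real_normK ?num_real// expr2 ler_wpM2l//.
  by rewrite (le_trans (sin_lip _ _))// distrC.
have [h0|/ltW h0] := leP 0 h.
  have ah : a <= a + h by rewrite lerDl.
  have [c] := MVT_segment ah (fun x _ => is_derive_cos x)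
    (continuous_subspaceT (@continuous_cos R)).
  rewrite in_itv/= => /andP[ac ch] ->; exists c; last by congr (_ * _); ring.
  by rewrite !ger0_norm ?subr_ge0//; lra.
have ah : a + h <= a by rewrite gerDl.
have [c] := MVT_segment ah (fun x _ => is_derive_cos x)
  (continuous_subspaceT (@continuous_cos R)).
rewrite in_itv/= => /andP[ac ch] E; exists c.
  by rewrite !ler0_norm ?subr_le0//; lra.
by rewrite -opprB E; ring.
Qed.

End CosineLipschitz.

Section TrigSeries.
Context (R : realType) (n : nat).
Implicit Types (b : nat -> R) (xi : nat -> 'rV[R]_n) (K : seq 'I_n -> R) (q : R).

(** The phase [q] makes the family stable under differentiation, which adds
    [pi / 2], and lets it contain both real and imaginary parts of waves. *)
Definition trig b xi q (x : 'rV[R]_n) : R :=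
  rsum (fun k => b k * cos (dot (xi k) x + q)).

(** Geometric decay with all polynomial weights in the frequency allows to
    differentiate term by term arbitrarily often. *)
Definition rapid b xi K :=
  forall k s, 0 <= monomial (xi k) s /\ `|b k| * monomial (xi k) s <= K s * 2^-1 ^+ k.

Definition times_monomial b xi s k : R := b k * monomial (xi k) s.

Lemma rapid_times b xi K s : rapid b xi K ->
  rapid (times_monomial b xi s) xi (fun t => K (s ++ t)).
Proof.
move=> bK k t; have [t0 _] := bK k t; have [s0 _] := bK k s; split=> //.
have [_] := bK k (s ++ t).
by rewrite monomial_cat mulrA normrM (ger0_norm s0).
Qed.

Lemma trig_geo b xi K q x : rapid b xi K ->
  geo_bounded (fun k => b k * cos (dot (xi k) x + q)) (K [::]).
Proof.
move=> bK k; have [_] := bK k [::]; rewrite /monomial big_nil mulr1.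
by apply: le_trans; rewrite normrM ler_piMr// ler_norml cos_geN1 cos_le1.
Qed.

Lemma trig_bound b xi K q x : rapid b xi K -> `|trig b xi q x| <= 2 * K [::].
Proof. by move=> bK; apply: geo_bounded_rsum; exact: trig_geo. Qed.

Lemma coord_le (x : 'rV[R]_n) i : `|x 0 i| <= `|x|.
Proof. by rewrite [`|x|]mx_normrE (le_bigmax _ (fun i => `|x i.1 i.2|) (0, i)). Qed.

Lemma continuous_trig b xi K q : rapid b xi K -> continuous (trig b xi q).
Proof.
move=> bK.
pose C := 2 * \sum_i K [:: i].
have lip x y : `|trig b xi q x - trig b xi q y| <= C * `|x - y|.
  rewrite /trig -(rsumB (trig_geo _ _ bK) (trig_geo _ _ bK)) /C -mulrA.
  apply: geo_bounded_rsum => k; rewrite -mulrBr normrM.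
  have dB : dot (xi k) x - dot (xi k) y = dot (xi k) (x - y).
    by rewrite -[in RHS]scaleN1r dotDr dotZr mulN1r.
  apply: (@le_trans _ _ (`|b k| * `|dot (xi k) (x - y)|)).
    rewrite ler_wpM2l// (le_trans (cos_lipschitz _ _))//.
    by rewrite opprD addrACA subrr addr0 dB.
  rewrite mulrAC; apply: (@le_trans _ _ (\sum_i (`|b k| * monomial (xi k) [:: i] * `|x - y|))).
    rewrite -mulr_suml -mulr_sumr -mulrA ler_wpM2l// /dot mulr_suml.
    apply: (le_trans (ler_norm_sum _ _ _)); apply: ler_sum => i _.
    have [i0 _] := bK k [:: i]; move: i0; rewrite /monomial big_seq1 => i0.
    by rewrite normrM ger0_norm// ler_wpM2l// coord_le.
  rewrite -mulr_suml ler_wpM2r// mulr_suml; apply: ler_sum => i _.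
  by have [] := bK k [:: i].
move=> x; apply/(@cvgrPdist_lt _ _ _ _ (nbhs_filter x)) => e e0.
have C0 : 0 < `|C| + 1 by rewrite ltr_wpDl.
apply/nbhs_ballP; exists (e / (`|C| + 1)) => [|y]; first exact: divr_gt0.
rewrite -ball_normE /= => xy; apply: (le_lt_trans (lip _ _)).
apply: (@le_lt_trans _ _ ((`|C| + 1) * `|x - y|)).
  by rewrite ler_wpM2r// (le_trans (ler_norm _))// lerDl.
by rewrite mulrC -ltr_pdivlMr.
Qed.

(** By [cos_taylor1], the error in the difference quotient is of the order of
    the increment times the sum of the [b k * xi k 0 i ^+ 2], which the decay
    with the weight of [[:: i; i]] controls. *)
Lemma is_derive_trig b xi K q x i : rapid b xi K ->
  is_derive x (delta_mx 0 i) (trig b xi q)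
    (trig (times_monomial b xi [:: i]) xi (q + pi / 2) x).
Proof.
move=> bK; set D := trig _ _ _ _.
pose C := 2 * K [:: i; i].
have taylor h : `|trig b xi q (h *: delta_mx 0 i + x) - trig b xi q x - h * D| <=
    C * h ^+ 2.
  have bK' := rapid_times [:: i] bK.
  have hD : geo_bounded (fun k => h * (times_monomial b xi [:: i] k *
      cos (dot (xi k) x + (q + pi / 2)))) (`|h| * K [:: i]).
    move=> k; rewrite normrM -[leRHS]mulrA; apply: ler_wpM2l => //.
    exact: (trig_geo _ _ bK').
  have dif : geo_bounded (fun k => b k * cos (dot (xi k) (h *: delta_mx 0 i + x) + q) -
      b k * cos (dot (xi k) x + q)) (2 * K [::]).
    move=> k; rewrite (le_trans (ler_normB _ _))// mulrDl mul1r mulrDl.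
    by apply: lerD; exact: (trig_geo _ _ bK).
  rewrite /D /trig -(rsumB (trig_geo _ _ bK) (trig_geo _ _ bK)).
  rewrite -(rsumZ h (trig_geo _ _ bK')) -(rsumB dif hD) /C -mulrA.
  apply: geo_bounded_rsum => k.
  have [_ bii] := bK k [:: i; i].
  rewrite dotDr dotZr.
  rewrite dotr_delta.
  rewrite /times_monomial /monomial big_seq1.
  set th := dot (xi k) x.
  have -> : h * xi k 0 i + th + q = (th + q) + h * xi k 0 i by ring.
  have -> : th + (q + pi / 2) = th + q + pi / 2 by ring.
  have := cos_taylor1 (th + q) (h * xi k 0 i).
  move: (cos _) (cos _) (cos _) => c3 c2 c1 H.
  have -> : b k * c1 - b k * c2 - h * (b k * xi k 0 i * c3) =
    b k * (c1 - c2 - h * xi k 0 i * c3) by ring.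
  rewrite normrM; apply: (le_trans (ler_wpM2l (normr_ge0 _) H)).
  rewrite [leRHS]mulrAC.
  move: bii; rewrite /monomial big_cons big_seq1 => /(ler_wpM2r (sqr_ge0 h)).
  by apply: le_trans; rewrite le_eqVlt; apply/orP; left; apply/eqP; ring.
have cv : (fun h : R => h^-1 *: ((trig b xi q \o shift x) (h *: delta_mx 0 i) -
    trig b xi q x)) @ 0^' --> D.
  apply/cvgrPdist_lt => e e0.
  have C0 : 0 < `|C| + 1 by rewrite ltr_wpDl.
  near=> h.
  have h0 : h != 0 by near: h; exact: nbhs_dnbhs_neq.
  have he : `|h| < e / (`|C| + 1).
    near: h; apply: dnbhs0_lt; exact: divr_gt0.
  rewrite /= -[_ *: _]/(_ * _).
  set T1 := trig b xi q (_ + _); set T2 := trig b xi q x.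
  have -> : D - h^-1 * (T1 - T2) = - (h^-1 * (T1 - T2 - h * D)).
    by field.
  rewrite normrN normrM normfV.
  apply: (@le_lt_trans _ _ (`|h|^-1 * (C * h ^+ 2))).
    by rewrite ler_wpM2l// taylor.
  rewrite -real_normK ?num_real//.
  have -> : `|h|^-1 * (C * `|h| ^+ 2) = C * `|h| by field; rewrite normr_eq0.
  apply: (@le_lt_trans _ _ ((`|C| + 1) * `|h|)).
    by rewrite ler_wpM2r// (le_trans (ler_norm _))// lerDl.
  by rewrite mulrC -ltr_pdivlMr.
apply: DeriveDef; first by apply/cvg_ex; exists D.
exact: cvg_lim cv.
Unshelve. all: by end_near. Qed.

Lemma partials_trig b xi K q s : rapid b xi K ->
  partials s (trig b xi q) =
  trig (times_monomial b xi s) xi (q + (size s)%:R * (pi / 2)).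
Proof.
move=> bK; elim: s => [|i s IH] /=.
  rewrite mul0r addr0; congr trig; apply/funext => k.
  by rewrite /times_monomial /monomial big_nil mulr1.
rewrite IH; apply/funext => x; rewrite /partial.
have [_ ->] := is_derive_trig (q + (size s)%:R * (pi / 2)) x i (rapid_times s bK).
congr (trig _ _ _ _); last by rewrite -[in RHS]addn1 natrD; ring.
apply/funext => k; rewrite /times_monomial monomial_cons /monomial big_seq1; ring.
Qed.

Lemma smooth_trig b xi K q : rapid b xi K -> smooth (trig b xi q).
Proof.
move=> bK s; rewrite (partials_trig _ _ bK); have bK' := rapid_times s bK.
split; first exact: continuous_trig bK'.
by move=> i x; have [] := is_derive_trig (q + (size s)%:R * (pi / 2)) x i bK'.
Qed.

End TrigSeries.

(** * The Leibniz rule along sequences of directions *)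

Section ComplexLeibniz.
Context (R : realType) (n : nat).
Implicit Types (f g : cfun R n) (s : seq 'I_n) (i : 'I_n).

Definition cpartials s f : cfun R n := fun x =>
  Complex (partials s (fun y => complex.Re (f y)) x)
          (partials s (fun y => complex.Im (f y)) x).

Definition cderivable i f x :=
  derivable (fun y => complex.Re (f y)) x (delta_mx 0 i) /\
  derivable (fun y => complex.Im (f y)) x (delta_mx 0 i).

Lemma cpartials_cons i s f : cpartials (i :: s) f = cpartials [:: i] (cpartials s f).
Proof. by []. Qed.

Lemma cpartials0 s : cpartials s (fun=> 0) = fun=> 0.
Proof.
have p0 : partials s (fun=> 0 : R) = fun=> 0 :> R.
  elim: s => // i s IH; rewrite /= IH; apply/funext => x.
  exact: derive_cst.
by apply/funext => x; rewrite /cpartials /= p0.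
Qed.

Lemma csmooth_continuous f s : csmooth f -> ccontinuous (cpartials s f).
Proof. by move=> [f1 f2]; split; [case: (f1 s)|case: (f2 s)]. Qed.

Lemma csmooth_derivable f s i x : csmooth f -> cderivable i (cpartials s f) x.
Proof.
by move=> [f1 f2]; split; [have [_] := f1 s|have [_] := f2 s]; exact.
Qed.

Lemma csmoothP f : (forall s, ccontinuous (cpartials s f)) ->
  (forall s i x, cderivable i (cpartials s f) x) -> csmooth f.
Proof.
move=> cf df; split=> s; split.
- by have [] := cf s.
- by move=> i x; have [] := df s i x.
- by have [] := cf s.
- by move=> i x; have [] := df s i x.
Qed.

Lemma ReM (z w : R[i]) : complex.Re (z * w) =
  complex.Re z * complex.Re w - complex.Im z * complex.Im w.
Proof. by case: z w => [? ?] [? ?]. Qed.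

Lemma ImM (z w : R[i]) : complex.Im (z * w) =
  complex.Re z * complex.Im w + complex.Im z * complex.Re w.
Proof. by case: z w => [? ?] [? ?]. Qed.

Lemma ReD (z w : R[i]) : complex.Re (z + w) = complex.Re z + complex.Re w.
Proof. by case: z w => [? ?] [? ?]. Qed.

Lemma ImD (z w : R[i]) : complex.Im (z + w) = complex.Im z + complex.Im w.
Proof. by case: z w => [? ?] [? ?]. Qed.

Lemma ccontinuousM f g : ccontinuous f -> ccontinuous g ->
  ccontinuous (fun x => f x * g x).
Proof.
move=> [f1 f2] [g1 g2]; split=> x.
  under eq_fun do rewrite ReM.
  apply: (@continuousB _ _ _ (fun x => complex.Re (f x) * complex.Re (g x))
    (fun x => complex.Im (f x) * complex.Im (g x))).
    by apply: continuousM; [exact: f1|exact: g1].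
  by apply: continuousM; [exact: f2|exact: g2].
under eq_fun do rewrite ImM.
apply: (@continuousD _ _ _ (fun x => complex.Re (f x) * complex.Im (g x))
  (fun x => complex.Im (f x) * complex.Re (g x))).
  by apply: continuousM; [exact: f1|exact: g2].
by apply: continuousM; [exact: f2|exact: g1].
Qed.

Lemma ccontinuousD f g : ccontinuous f -> ccontinuous g ->
  ccontinuous (fun x => f x + g x).
Proof.
move=> [f1 f2] [g1 g2]; split=> x.
  under eq_fun do rewrite ReD.
  by apply: (@continuousD _ _ _ (fun x => complex.Re (f x)) (fun x => complex.Re (g x)));
    [exact: f1|exact: g1].
under eq_fun do rewrite ImD.
by apply: (@continuousD _ _ _ (fun x => complex.Im (f x)) (fun x => complex.Im (g x)));
  [exact: f2|exact: g2].
Qed.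

Lemma cderivM i f g x : cderivable i f x -> cderivable i g x ->
  cderivable i (fun y => f y * g y) x /\
  cpartials [:: i] (fun y => f y * g y) x =
    cpartials [:: i] f x * g x + f x * cpartials [:: i] g x.
Proof.
move=> [f1 f2] [g1 g2].
have ReE : (fun y => complex.Re (f y * g y)) =
    ((fun y => complex.Re (f y)) * (fun y => complex.Re (g y))) -
    ((fun y => complex.Im (f y)) * (fun y => complex.Im (g y))).
  by apply/funext => y; rewrite ReM.
have ImE : (fun y => complex.Im (f y * g y)) =
    ((fun y => complex.Re (f y)) * (fun y => complex.Im (g y))) +
    ((fun y => complex.Im (f y)) * (fun y => complex.Re (g y))).
  by apply/funext => y; rewrite ImM.
rewrite /cderivable /cpartials /= /partial ReE ImE.
have d1 := derivableM f1 g1; have d2 := derivableM f2 g2.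
have d3 := derivableM f1 g2; have d4 := derivableM f2 g1.
split; first by split; [exact: (derivableB d1 d2)|exact: (derivableD d3 d4)].
rewrite (deriveB d1 d2) (deriveD d3 d4).
rewrite (deriveM f1 g1) (deriveM f2 g2) (deriveM f1 g2) (deriveM f2 g1).
rewrite -![_ *: _]/(_ * _).
move: ('D_ _ _ _) ('D_ _ _ _) ('D_ _ _ _) ('D_ _ _ _) => a b c d.
by case: (f x) (g x) => [p q] [r t]/=; apply/eqP; rewrite eq_complex/=;
  apply/andP; split; apply/eqP; ring.
Qed.

Lemma cderivD i f g x : cderivable i f x -> cderivable i g x ->
  cderivable i (fun y => f y + g y) x /\
  cpartials [:: i] (fun y => f y + g y) x =
    cpartials [:: i] f x + cpartials [:: i] g x.
Proof.
move=> [f1 f2] [g1 g2].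
have ReE : (fun y => complex.Re (f y + g y)) =
    (fun y => complex.Re (f y)) + (fun y => complex.Re (g y)).
  by apply/funext => y; rewrite ReD.
have ImE : (fun y => complex.Im (f y + g y)) =
    (fun y => complex.Im (f y)) + (fun y => complex.Im (g y)).
  by apply/funext => y; rewrite ImD.
rewrite /cderivable /cpartials /= /partial ReE ImE.
split; first by split; [exact: (derivableD f1 g1)|exact: (derivableD f2 g2)].
by rewrite (deriveD f1 g1) (deriveD f2 g2).
Qed.

(** In the Leibniz rule along a sequence of directions, each derivative falls on
    one of the two factors; keeping the [2 ^ size s] terms apart avoids
    binomial coefficients of multi-indices. *)
Fixpoint splits s : seq (seq 'I_n * seq 'I_n) :=
  if s is i :: s' then
    [seq (i :: p.1, p.2) | p <- splits s'] ++
    [seq (p.1, i :: p.2) | p <- splits s']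
  else [:: ([::], [::])].

Lemma mderiv0 f : mderiv 0 f = f.
Proof.
have s0 : multi_seq (0 : multi n) = [::].
  by apply: size0nil; rewrite size_multi_seq /mdeg big1// => i _; rewrite ffunE.
by apply/funext => x; rewrite /mderiv s0/=; case: (f x).
Qed.

Lemma cderiv_sum i (I : Type) (r : seq I) (F : I -> cfun R n) x :
  (forall j, cderivable i (F j) x) ->
  cderivable i (fun y => \sum_(j <- r) F j y) x /\
  cpartials [:: i] (fun y => \sum_(j <- r) F j y) x =
    \sum_(j <- r) cpartials [:: i] (F j) x.
Proof.
move=> dF; elim: r => [|j r [IH1 IH2]].
  have -> : (fun y => \sum_(j <- [::]) F j y) = fun=> 0.
    by apply/funext => y; rewrite big_nil.
  by rewrite big_nil cpartials0; split.
have -> : (fun y => \sum_(k <- j :: r) F k y) =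
    fun y => F j y + \sum_(k <- r) F k y.
  by apply/funext => y; rewrite big_cons.
by have [d ->] := cderivD (dF j) IH1; rewrite big_cons IH2.
Qed.

Lemma cpartialsM f g s : csmooth f -> csmooth g ->
  cpartials s (fun x => f x * g x) = fun x =>
    \sum_(p <- splits s) cpartials p.1 f x * cpartials p.2 g x.
Proof.
move=> sf sg; elim: s => [|i s IH].
  apply/funext => x; rewrite /= big_seq1 /cpartials/=.
  by case: (f x * g x) (f x) (g x) => [? ?] [? ?] [? ?].
rewrite cpartials_cons IH; apply/funext => x /=.
have dM (p : seq 'I_n * seq 'I_n) : cderivable i
    (fun y => cpartials p.1 f y * cpartials p.2 g y) x.
  by have [] := cderivM (csmooth_derivable p.1 i x sf) (csmooth_derivable p.2 i x sg).
have [_ ->] := cderiv_sum (splits s) dM.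
rewrite big_cat/= !big_map -big_split/=; apply: eq_bigr => p _.
by have [_ ->] := cderivM (csmooth_derivable p.1 i x sf) (csmooth_derivable p.2 i x sg).
Qed.

Lemma csmoothM f g : csmooth f -> csmooth g -> csmooth (fun x => f x * g x).
Proof.
move=> sf sg; apply: csmoothP => s; rewrite cpartialsM//.
  elim: (splits s) => [|p r IH].
    have -> : (fun x => \sum_(p <- [::]) cpartials p.1 f x * cpartials p.2 g x) =
        fun=> 0 by apply/funext => x; rewrite big_nil.
    by split; exact: cst_continuous.
  have -> : (fun x => \sum_(q <- p :: r) cpartials q.1 f x * cpartials q.2 g x) =
      fun x => cpartials p.1 f x * cpartials p.2 g x +
               \sum_(q <- r) cpartials q.1 f x * cpartials q.2 g x.
    by apply/funext => x; rewrite big_cons.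
  by apply: ccontinuousD => //; apply: ccontinuousM; exact: csmooth_continuous.
move=> i x.
have dM (p : seq 'I_n * seq 'I_n) : cderivable i
    (fun y => cpartials p.1 f y * cpartials p.2 g y) x.
  by have [] := cderivM (csmooth_derivable p.1 i x sf) (csmooth_derivable p.2 i x sg).
by have [] := cderiv_sum (splits s) dM.
Qed.

Lemma size_splits s : size (splits s) = (2 ^ size s)%N.
Proof. by elim: s => //= i s IH; rewrite size_cat !size_map IH addnn expnS mul2n. Qed.

Lemma splits_subseq s p : p \in splits s -> subseq p.1 s /\ subseq p.2 s.
Proof.
elim: s p => [|i s IH] p /=; first by rewrite inE => /eqP ->.
rewrite mem_cat => /orP[] /mapP[q /IH[q1 q2] ->] /=; split=> //.
- by rewrite eqxx.
- by apply: subseq_trans q2 (subseq_cons _ _).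
- by apply: subseq_trans q1 (subseq_cons _ _).
- by rewrite eqxx.
Qed.

Lemma splits_perm s p : p \in splits s -> perm_eq (p.1 ++ p.2) s.
Proof.
elim: s p => [|i s IH] p /=; first by rewrite inE => /eqP ->.
rewrite mem_cat => /orP[] /mapP[q /IH pq ->] /=; first by rewrite perm_cons.
by rewrite -cat1s perm_catCA/= perm_cons.
Qed.

(** Both parts of a split of a sorted sequence are sorted, hence come from
    multi-indices again. *)
Lemma splits_multi (a : multi n) p : p \in splits (multi_seq a) ->
  [/\ multi_seq (counts p.1) = p.1, multi_seq (counts p.2) = p.2 &
      counts p.1 + counts p.2 = a].
Proof.
move=> pa; have [p1 p2] := splits_subseq pa.
have sa := sorted_multi_seq a.
split; try by apply: sorted_multiE; apply: subseq_sorted sa => //; exact: ord_le_trans.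
by rewrite -counts_cat (eq_counts (splits_perm pa)) counts_multi_seq.
Qed.

(** Isolates the term of the Leibniz rule of top degree in the frequency: a
    single split puts all derivatives on the second factor. *)
Lemma splits_full (V : nmodType) s (F : seq 'I_n * seq 'I_n -> V) :
  \sum_(p <- splits s) (if size p.2 == size s then F p else 0) = F ([::], s).
Proof.
elim: s F => [|i s IH] F /=; first by rewrite big_seq1.
rewrite big_cat/= !big_map/= [X in X + _]big1_seq ?add0r; last first.
  move=> p /andP[_ /splits_perm/perm_size]; rewrite size_cat => <-.
  by rewrite -addSn -[X in X == _]add0n eqn_add2r.
by under eq_bigr do rewrite eqSS; rewrite (IH (fun p => F (p.1, i :: p.2))).
Qed.

End ComplexLeibniz.

(** * Superpositions of waves *)

Section Waves.
Context (R : realType) (n : nat).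
Implicit Types (b : nat -> R) (xi : nat -> 'rV[R]_n) (K : seq 'I_n -> R) (q : R).

(** The sum of the [b k * expi (dot (xi k) x + q)], with the sine written as a
    cosine of phase shifted by [- (pi / 2)]. *)
Definition wave b xi q : cfun R n := fun x =>
  Complex (trig b xi q x) (trig b xi (q - pi / 2) x).

Lemma csmooth_wave b xi K q : rapid b xi K -> csmooth (wave b xi q).
Proof. by move=> bK; split; exact: smooth_trig bK. Qed.

Lemma cpartials_wave b xi K q s : rapid b xi K ->
  cpartials s (wave b xi q) =
  wave (times_monomial b xi s) xi (q + (size s)%:R * (pi / 2)).
Proof.
move=> bK; apply/funext => x; rewrite /cpartials.
rewrite -[fun y => complex.Re _]/(trig b xi q).
rewrite -[fun y => complex.Im _]/(trig b xi (q - pi / 2)).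
rewrite !(partials_trig _ _ bK) /wave; congr (Complex _ (trig _ _ _ _)).
by rewrite addrAC.
Qed.

Lemma cmod_wave b xi K q x : rapid b xi K -> cmod (wave b xi q x) <= 4 * K [::].
Proof.
move=> bK; apply: (le_trans (cmod_le_ReIm _)) => /=.
have := trig_bound q x bK; have := trig_bound (q - pi / 2) x bK.
by lra.
Qed.

Lemma waveB b b' xi K K' q x : rapid b xi K -> rapid b' xi K' ->
  wave (fun k => b k - b' k) xi q x = wave b xi q x - wave b' xi q x.
Proof.
move=> bK bK'.
have E p : trig (fun k => b k - b' k) xi p x = trig b xi p x - trig b' xi p x.
  rewrite /trig -(rsumB (trig_geo _ _ bK) (trig_geo _ _ bK')); congr rsum.
  by apply/funext => k; rewrite mulrBl.
by rewrite /wave !E; apply/eqP; rewrite eq_complex/= !eqxx.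
Qed.

Definition single (k : nat) (c : R) j : R := if j == k then c else 0.

Definition expi (t : R) : R[i] := Complex (cos t) (sin t).

Lemma cmod_expi t : cmod (expi t) = 1.
Proof. by rewrite cmodE/= cos2Dsin2 sqrtr1. Qed.

Lemma wave_single k c xi s m x :
  wave (times_monomial (single k c) xi s) xi (m%:R * (pi / 2)) x =
  Complex (c * monomial (xi k) s) 0 * 'i%C ^+ m * expi (dot (xi k) x).
Proof.
have T p : trig (times_monomial (single k c) xi s) xi p x =
    c * monomial (xi k) s * cos (dot (xi k) x + p).
  rewrite -[RHS](rsum_single k); congr rsum; apply/funext => j.
  by rewrite /times_monomial /single; case: eqP => [->//|_]; rewrite !mul0r.
have E : forall t, expi (t + m%:R * (pi / 2)) = 'i%C ^+ m * expi t :> R[i].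
  elim: m => [|m IH] t; first by rewrite mul0r addr0 expr0 mul1r.
  have -> : t + m.+1%:R * (pi / 2) = t + m%:R * (pi / 2) + pi / 2.
    by rewrite -addn1 natrD; ring.
  rewrite exprS -mulrA -IH; apply/eqP; rewrite eq_complex/= cosDpihalf sinDpihalf.
  by apply/andP; split; apply/eqP; ring.
rewrite -mulrA -E /wave !T; apply/eqP; rewrite eq_complex/=.
rewrite -[in X in _ && X]sinDpihalf.
have -> : dot (xi k) x + (m%:R * (pi / 2) - pi / 2) + pi / 2 =
  dot (xi k) x + m%:R * (pi / 2) by ring.
by apply/andP; split; apply/eqP; ring.
Qed.

Lemma rapid_single k c xi : (forall j i, 0 <= xi j 0 i) ->
  rapid (single k c) xi (fun s => `|c| * monomial (xi k) s * 2 ^+ k).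
Proof.
move=> x0 j s; split; first exact: monomial_ge0.
rewrite /single; case: eqP => [->|_].
  by rewrite -[leRHS]mulrA -exprMn divff// expr1n mulr1.
by rewrite normr0 mul0r !mulr_ge0// monomial_ge0.
Qed.

End Waves.

(** * Modulations of a fixed function *)

Section FiniteDifference.

(** By induction on [d]: the factor [j.+1] is absorbed by the binomial
    coefficient, and the remaining power of [j.+1] is expanded in powers of
    [j], to which the case of [d] applies. *)
Lemma finite_difference (F : comNzRingType) d m : (m <= d)%N ->
  \sum_(j < d.+1) (-1) ^+ (d - j) * 'C(d, j)%:R * j%:R ^+ m =
  (if m == d then d`!%:R else 0) :> F.
Proof.
elim: d m => [|d IH] [|m] //.
- by rewrite big_ord_recl big_ord0 => _; rewrite subn0 bin0 !expr0 !mulr1 addr0.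
- move=> _; have := exprDn (-1 : F) 1 d.+1; rewrite addNr expr0n/= => E.
  rewrite [RHS]E; apply: eq_bigr => j _.
  by rewrite expr0 expr1n !mulr1 mulr_natr.
rewrite ltnS eqSS => md; rewrite big_ord_recl/= expr0n/= mulr0 add0r.
transitivity (d.+1%:R * \sum_(l < m.+1) 'C(m, l)%:R *
    (\sum_(j < d.+1) (-1) ^+ (d - j) * 'C(d, j)%:R * j%:R ^+ l) : F).
  rewrite mulr_sumr; under [RHS]eq_bigr => l _ do rewrite !mulr_sumr.
  rewrite exchange_big/=; apply: eq_bigr => j _.
  rewrite /bump/= add1n subSS exprS.
  have -> : (-1) ^+ (d - j) * 'C(d.+1, j.+1)%:R * (j.+1%:R * j.+1%:R ^+ m) =
      (-1) ^+ (d - j) * (j.+1 * 'C(d.+1, j.+1))%:R * j.+1%:R ^+ m :> F.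
    by rewrite natrM; ring.
  rewrite -mul_bin_diag natrM -[j.+1%:R in LHS]natr1 exprD1n -mulr_natl.
  rewrite mulr_sumr; apply: eq_bigr => l _; rewrite mulr_natl -mulr_natr; ring.
have H (l : 'I_m.+1) : \sum_(j < d.+1) (-1) ^+ (d - j) * 'C(d, j)%:R * j%:R ^+ l =
    (if l == d :> nat then d`!%:R else 0) :> F.
  by apply: IH; apply: leq_trans md; rewrite -ltnS.
under eq_bigr => l _ do rewrite H.
rewrite big_ord_recr/= binn mul1r big1 ?add0r => [|l _]; last first.
  by rewrite ltn_eqF ?mulr0// (leq_trans (ltn_ord l)).
by case: eqP => _; rewrite ?mulr0// -natrM factS.
Qed.

Lemma exp_fact (R : realType) d : d%:R ^+ d <= expR 1 ^+ d * d`!%:R :> R.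
Proof.
elim: d => [|d IH]; first by rewrite !expr0 fact0 mulr1.
have [->|d0] := eqVneq d 0%N.
  by rewrite !expr1 mulr1 (le_trans _ (expR_ge1Dx 1))// lerDl.
have dR : 0 < d%:R :> R by rewrite ltr0n lt0n.
have e0 := expR_gt0 (1 : R).
have step : d.+1%:R ^+ d <= expR 1 * d%:R ^+ d :> R.
  have -> : d.+1%:R = d%:R * (1 + d%:R^-1) :> R.
    by rewrite mulrDr mulr1 divff ?lt0r_neq0// natr1.
  rewrite exprMn mulrC ler_wpM2r ?exprn_ge0//.
  apply: (@le_trans _ _ (expR d%:R^-1 ^+ d)).
    by apply: lerXn2r; rewrite ?nnegrE ?expR_ge0 ?expR_ge1Dx// addr_ge0// invr_ge0.
  by rewrite -expRM_natr mulVf// lt0r_neq0.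
rewrite exprS factS natrM exprS.
rewrite [leRHS](_ : _ = d.+1%:R * (expR 1 * (expR 1 ^+ d * d`!%:R))); last by ring.
rewrite ler_wpM2l//.
apply: (le_trans step); rewrite ler_wpM2l ?expR_ge0//.
Qed.

End FiniteDifference.

Section Modulation.
Context (R : realType) (n : nat) (E : tibf R n) (solidE : solid E).
Variables (f0 : cfun R n) (smooth0 : csmooth f0).
Implicit Types (b : nat -> R) (xi : nat -> 'rV[R]_n) (K : seq 'I_n -> R).

Definition modulate b xi : cfun R n := fun x => f0 x * wave b xi 0 x.

Lemma csmooth_modulate b xi K : rapid b xi K -> csmooth (modulate b xi).
Proof. by move=> bK; apply: csmoothM => //; exact: csmooth_wave bK. Qed.

Lemma mderiv_modulate a b xi K : rapid b xi K ->
  mderiv a (modulate b xi) = fun x => \sum_(p <- splits (multi_seq a))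
    cpartials p.1 f0 x *
    wave (times_monomial b xi p.2) xi ((size p.2)%:R * (pi / 2)) x.
Proof.
move=> bK; have sw := csmooth_wave 0 bK.
rewrite [LHS](cpartialsM (multi_seq a) smooth0 sw); apply/funext => x.
by apply: eq_bigr => p _; rewrite (cpartials_wave _ _ bK) add0r.
Qed.

Lemma eq_modulate b xi xi' : (forall j, b j != 0 -> xi j = xi' j) ->
  modulate b xi = modulate b xi'.
Proof.
move=> e; have T q x : trig b xi q x = trig b xi' q x.
  congr rsum; apply/funext => j.
  by have [->|/e ->//] := eqVneq (b j) 0; rewrite !mul0r.
by apply/funext => x; rewrite /modulate /wave !T.
Qed.

Lemma mderiv_modulateB a b b' xi K K' : rapid b xi K -> rapid b' xi K' ->
  mderiv a (modulate (fun k => b k - b' k) xi) =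
  fun x => mderiv a (modulate b xi) x - mderiv a (modulate b' xi) x.
Proof.
move=> bK bK'; have bKB : rapid (fun k => b k - b' k) xi (fun s => K s + K' s).
  move=> k s; have [s0 bk] := bK k s; have [_ bk'] := bK' k s; split=> //.
  rewrite mulrDl (le_trans _ (lerD bk bk'))// -mulrDl ler_wpM2r//.
  exact: ler_normB.
rewrite (mderiv_modulate _ bK) (mderiv_modulate _ bK') (mderiv_modulate _ bKB).
apply/funext => x; rewrite -sumrB; apply: eq_bigr => p _.
rewrite -mulrBr; congr (_ * _).
rewrite -(waveB _ _ (rapid_times p.2 bK) (rapid_times p.2 bK')).
by congr (wave _ _ _ _); apply/funext => k; rewrite /times_monomial mulrBl.
Qed.

Lemma rapid_ge0 b xi K s : rapid b xi K -> 0 <= K s.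
Proof.
move=> /(_ 0%N s)[s0]; rewrite expr0 mulr1; apply: le_trans.
exact: mulr_ge0.
Qed.

(** By the Leibniz rule and solidity, since the derivatives of the wave are
    bounded functions. *)
Lemma weighted_modulate w a b xi K :
  (forall c, tibf_set E (weighted w (mderiv c f0))) -> rapid b xi K ->
  tibf_set E (weighted w (mderiv a (modulate b xi))) /\
  tibf_norm E (weighted w (mderiv a (modulate b xi))) <=
    \sum_(p <- splits (multi_seq a))
      4 * K p.2 * tibf_norm E (weighted w (mderiv (counts p.1) f0)).
Proof.
move=> wE bK.
pose F (p : seq 'I_n * seq 'I_n) : cfun R n := fun x =>
  weighted w (cpartials p.1 f0) x *
  wave (times_monomial b xi p.2) xi ((size p.2)%:R * (pi / 2)) x.
have -> : weighted w (mderiv a (modulate b xi)) =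
    fun x => \sum_(p <- splits (multi_seq a)) F p x.
  apply/funext => x; rewrite /weighted (mderiv_modulate _ bK) mulr_suml.
  by apply: eq_bigr => p _; rewrite /F /weighted mulrAC.
have EF p : p \in splits (multi_seq a) -> tibf_set E (F p) /\
    tibf_norm E (F p) <=
    4 * K p.2 * tibf_norm E (weighted w (mderiv (counts p.1) f0)).
  move=> /splits_multi[p1 _ _].
  have Ep := wE (counts p.1); rewrite /mderiv p1 in Ep *.
  have bKp := rapid_times p.2 bK.
  have K0 : 0 <= 4 * K p.2 by rewrite mulr_ge0// (rapid_ge0 _ bK).
  have cw := csmooth_continuous [::] (csmooth_wave ((size p.2)%:R * (pi / 2)) bKp).
  apply: (solid_mul solidE K0 Ep (ccontinuous_measurable cw)) => x.
  have -> : K p.2 = K (p.2 ++ [::]) by rewrite cats0.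
  exact: (cmod_wave ((size p.2)%:R * (pi / 2)) x bKp).
have [|EF1 EF2] := tibf_sum (r := splits (multi_seq a)) (F := F) (E := E).
  by move=> p /EF[].
split=> //; apply: (le_trans EF2); rewrite !big_seq; apply: ler_sum => p.
by move=> /EF[].
Qed.

Lemma weighted1 (f : cfun R n) : weighted (fun=> 1) f = f.
Proof.
apply/funext => x; rewrite /weighted; case: (f x) => u v; apply/eqP.
by rewrite eq_complex/= !mulr1 !mulr0 subr0 add0r !eqxx.
Qed.

Hypothesis E0 : forall c, tibf_set E (mderiv c f0).

Lemma norm_modulate a b xi K : rapid b xi K ->
  tibf_set E (mderiv a (modulate b xi)) /\
  tibf_norm E (mderiv a (modulate b xi)) <=
    \sum_(p <- splits (multi_seq a))
      4 * K p.2 * tibf_norm E (mderiv (counts p.1) f0).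
Proof.
move=> bK; have := @weighted_modulate (fun=> 1) a b xi K _ bK; rewrite weighted1.
under eq_bigr do rewrite weighted1.
by apply=> c; rewrite weighted1.
Qed.

End Modulation.

Section LowerBound.
Context (R : realType) (n : nat) (E : tibf R n) (solidE : solid E).
Variables (f0 : cfun R n) (smooth0 : csmooth f0).
Hypothesis E0 : forall c, tibf_set E (mderiv c f0).

(** Up to the unimodular factor [expi (s * dot x y)], the derivative of order
    [a] of [f0] modulated at the frequency [s *: x] is a polynomial in [s] with
    values in [E], of degree [mdeg a] and with leading coefficient
    [monomial x (multi_seq a) * 'i ^+ mdeg a * f0]. A finite difference with step
    [(mdeg a)^-1] in [0, 1] extracts this coefficient. *)
Lemma modulate_lower_bound a (x : 'rV[R]_n) (c : R) : (forall i, 0 < x 0 i) ->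
  0 <= c -> exists2 s : R, 0 <= s <= 1 &
  forall k (xi : nat -> 'rV[R]_n), (forall j i, 0 <= xi j 0 i) ->
    xi k = s *: x ->
    c * monomial x (multi_seq a) * tibf_norm E f0 <=
    (2 * expR 1) ^+ mdeg a * tibf_norm E (mderiv a (modulate f0 (single k c) xi)).
Proof.
move=> x0 c0; set d := mdeg a.
pose P (s : R) : cfun R n := fun y => \sum_(p <- splits (multi_seq a))
  Complex (s ^+ size p.2 * monomial x p.2) 0 * 'i%C ^+ size p.2 * cpartials p.1 f0 y.
have EP s : tibf_set E (P s).
  have [|//] := tibf_sum (E := E) (r := splits (multi_seq a)) (F := fun p y =>
    Complex (s ^+ size p.2 * monomial x p.2) 0 * 'i%C ^+ size p.2 * cpartials p.1 f0 y).
  move=> p /splits_multi[p1 _ _]; apply: tibf_setZ.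
  by have := E0 (counts p.1); rewrite /mderiv p1.
have f0E : tibf_set E f0 by rewrite -(mderiv0 f0).
pose node (j : nat) : R := j%:R / d%:R.
pose wt (j : nat) : R := (-1) ^+ (d - j) * 'C(d, j)%:R.
have d0 : 0 <= d%:R :> R by [].
have key : (fun y => \sum_(j < d.+1) Complex (wt j) 0 * P (node j) y) =
    fun y => Complex (d`!%:R * d%:R ^- d * monomial x (multi_seq a)) 0 *
      'i%C ^+ d * f0 y.
  apply/funext => y; rewrite /P.
  under eq_bigr => j _ do rewrite mulr_sumr.
  rewrite exchange_big/=.
  pose G (p : seq 'I_n * seq 'I_n) := Complex (d`!%:R * d%:R ^- d * monomial x p.2) 0 *
    'i%C ^+ d * cpartials p.1 f0 y.
  have szd : size (multi_seq a) = d by rewrite size_multi_seq.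
  transitivity (\sum_(p <- splits (multi_seq a))
      (if size p.2 == size (multi_seq a) then G p else 0)); last first.
    rewrite splits_full /G /=; congr (_ * _).
    by rewrite /cpartials/=; case: (f0 y).
  rewrite big_seq [RHS]big_seq; apply: eq_bigr => p ps.
  have pd : (size p.2 <= d)%N.
    by rewrite -szd; have [_ /size_subseq] := splits_subseq ps.
  have C0 : {morph (fun r : R => Complex r 0) : u v / u * v}.
    move=> u v; apply/eqP; rewrite eq_complex/=.
    by rewrite !mulr0 !mul0r subr0 addr0 !eqxx.
  have CD : {morph (fun r : R => Complex r 0) : u v / u + v}.
    by move=> u v; apply/eqP; rewrite eq_complex/= addr0 !eqxx.
  transitivity (Complex (\sum_(j < d.+1) wt j * (node j ^+ size p.2 * monomial x p.2)) 0
      * 'i%C ^+ size p.2 * cpartials p.1 f0 y).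
    rewrite (big_morph (fun r => Complex r 0) CD erefl) !mulr_suml.
    by apply: eq_bigr => j _; rewrite !C0 !mulrA.
  have -> : \sum_(j < d.+1) wt j * (node j ^+ size p.2 * monomial x p.2) =
      (if size p.2 == d then d`!%:R else 0) * d%:R ^- size p.2 * monomial x p.2.
    rewrite -(finite_difference _ pd) !mulr_suml; apply: eq_bigr => j _.
    by rewrite /wt /node expr_div_n !mulrA.
  rewrite szd /G; case: eqP => [->//|_].
  by rewrite !mul0r.
pose B := d`!%:R * d%:R ^- d * monomial x (multi_seq a).
have m0 : 0 <= monomial x (multi_seq a) by apply: monomial_ge0 => i; exact: ltW.
have B0 : 0 <= B by rewrite !mulr_ge0// invr_ge0 exprn_ge0.
have ci m : cmod ('i%C ^+ m : R[i]) = 1.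
  elim: m => [|m IH]; first by rewrite expr0 cmodE/= expr1n expr0n/= addr0 sqrtr1.
  by rewrite exprS cmodM IH mulr1 cmodE/= expr0n expr1n/= add0r sqrtr1.
have sumP : B * tibf_norm E f0 <= \sum_(j < d.+1) 'C(d, j)%:R * tibf_norm E (P (node j)).
  have <- : tibf_norm E (fun y => Complex B 0 * 'i%C ^+ d * f0 y) = B * tibf_norm E f0.
    by rewrite tibf_normZ// cmodM ci cmod_real mulr1 ger0_norm.
  rewrite -key.
  have [|_ H] := tibf_sum (E := E) (r := enum 'I_d.+1)
    (F := fun j y => Complex (wt j) 0 * P (node j) y).
    by move=> j _; exact: tibf_setZ.
  move: H; under eq_fun do rewrite big_enum/=.
  rewrite big_enum/= => /le_trans; apply; apply: ler_sum => j _.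
  rewrite tibf_normZ// cmod_real /wt normrM normrX normrN1 expr1n mul1r.
  by rewrite ger0_norm.
(* The binomial coefficients sum up to [2 ^+ d], so that one of the nodes
   does at least as well as their average. *)
have [j Bj] : exists j : 'I_d.+1, B * tibf_norm E f0 <= 2 ^+ d * tibf_norm E (P (node j)).
  apply: contrapT => /forallNP H.
  have lt j : 2 ^+ d * tibf_norm E (P (node j)) < B * tibf_norm E f0 \/ (d < j)%N.
    have [jd|] := leqP j d; last by right.
    by left; have /negP := H (Ordinal (jd : (j < d.+1)%N)); rewrite -ltNge.
  have two0 : 0 < 2 ^+ d :> R by rewrite exprn_gt0.
  have sumC : \sum_(j < d.+1) 'C(d, j)%:R = 2 ^+ d :> R.
    have := exprDn (1 : R) 1 d; rewrite -[1 + 1]/(2%:R) => ->.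
    by apply: eq_bigr => j _; rewrite !expr1n mulr1.
  have : 2 ^+ d * (\sum_(j < d.+1) 'C(d, j)%:R * tibf_norm E (P (node j))) <
         2 ^+ d * (B * tibf_norm E f0).
    rewrite -[in ltRHS]sumC mulr_sumr mulr_suml; apply: ltr_sum.
      by apply/hasP; exists ord0; rewrite // mem_index_enum.
    move=> j _; rewrite mulrCA ltr_pM2l; last by rewrite ltr0n bin_gt0 -ltnS.
    by case: (lt j) => // dj; move: (ltn_ord j); rewrite ltnS leqNgt dj.
  by rewrite ltr_pM2l// ltNge sumP.
exists (node j).
  rewrite divr_ge0//=; have [d00|d00] := eqVneq d 0%N.
    by rewrite /node (_ : d%:R = 0 :> R) ?invr0 ?mulr0// d00.
  by rewrite ler_pdivrMr ?ltr0n ?lt0n// mul1r ler_nat -ltnS.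
move=> k xi xi0 xik.
have bK := rapid_single k c xi0.
have [EQ _] := norm_modulate solidE smooth0 E0 a bK.
have cP : c * tibf_norm E (P (node j)) <=
    tibf_norm E (mderiv a (modulate f0 (single k c) xi)).
  have <- : tibf_norm E (fun y => Complex c 0 * P (node j) y) =
      c * tibf_norm E (P (node j)).
    by rewrite tibf_normZ// cmod_real ger0_norm.
  have mcP := L1loc_measurable (tibf_L1loc (tibf_setZ (Complex c 0) (EP (node j)))).
  have [] := solid_le solidE EQ mcP; last by move=> _.
  move=> y; rewrite (mderiv_modulate smooth0 _ bK) le_eqVlt; apply/orP; left; apply/eqP.
  transitivity (cmod (expi (dot (xi k) y) * (Complex c 0 * P (node j) y))).
    by rewrite [RHS]cmodM cmod_expi mul1r.
  congr cmod; rewrite /P !mulr_sumr; apply: eq_bigr => p _.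
  rewrite wave_single xik monomialZ.
  have -> : Complex (c * (node j ^+ size p.2 * monomial x p.2)) 0 =
      Complex c 0 * Complex (node j ^+ size p.2 * monomial x p.2) 0.
    apply/eqP; rewrite eq_complex/=.
    by rewrite !mulr0 !mul0r subr0 addr0 !eqxx.
  ring.
have dd : d%:R ^+ d <= expR 1 ^+ d * d`!%:R :> R by exact: exp_fact.
have dd0 : 0 < d%:R ^+ d :> R.
  by have [->|d00] := eqVneq d 0%N; rewrite ?expr0// exprn_gt0// ltr0n lt0n.
have step : monomial x (multi_seq a) <= expR 1 ^+ d * B.
  rewrite /B mulrA ler_peMl// mulrA -ler_pdivrMr ?invr_gt0// invrK mul1r//.
rewrite exprMn -mulrA.
apply: (@le_trans _ _ (c * (expR 1 ^+ d * B * tibf_norm E f0))).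
  by rewrite ler_wpM2l// ler_wpM2r// tibf_norm_ge0.
apply: (@le_trans _ _ (c * (expR 1 ^+ d * (2 ^+ d * tibf_norm E (P (node j)))))).
  rewrite ler_wpM2l// -mulrA ler_wpM2l// exprn_ge0// expR_ge0.
have -> : c * (expR 1 ^+ d * (2 ^+ d * tibf_norm E (P (node j)))) =
  2 ^+ d * expR 1 ^+ d * (c * tibf_norm E (P (node j))) by ring.
by rewrite ler_wpM2l// mulr_ge0// exprn_ge0// expR_ge0.
Qed.

End LowerBound.

(** * The gliding hump *)

Section GlidingHump.
Context (R : realType) (n : nat) (E : tibf R n) (solidE : solid E).
Variables (f0 : cfun R n) (smooth0 : csmooth f0).
Hypothesis E0 : forall c, tibf_set E (mderiv c f0).
Hypothesis norm0 : 0 < tibf_norm E f0.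
Variables (M N : nat -> multi n -> R).
Hypothesis wsM : forall k, weight_sequence (M k).
Hypothesis lcM : forall k, log_convex_sequence (M k).
Hypothesis M_le : forall k a, M k a <= M 0%N a.
Hypothesis N_gt0 : forall k a, 0 < N k a.
Hypothesis MN : forall k (C : R), 0 < C ->
  exists a, C * (2 * expR 1) ^+ mdeg a * N k a < M k a.

Local Notation step := (R * 'rV[R]_n * multi n)%type.
Implicit Types (h : seq step) (t : step) (a : multi n).

Let dflt : step := (0, 0, 0).
Let coef h j : R := (nth dflt h j).1.1.
Let freq h j : 'rV[R]_n := (nth dflt h j).1.2.

Let nonneg t := 0 <= t.1.1 /\ forall i, 0 <= t.1.2 0 i.

Let nth_nonneg h j : (forall t, t \in h -> nonneg t) -> nonneg (nth dflt h j).
Proof.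
move=> hh; have [jh|hj] := ltnP j (size h); first exact/hh/mem_nth.
by rewrite nth_default//; split=> //= i; rewrite mxE.
Qed.

Let rapid_history h : (forall t, t \in h -> nonneg t) -> rapid (coef h) (freq h)
  (fun s => \sum_(j < size h) coef h j * monomial (freq h j) s * 2 ^+ j).
Proof.
move=> hh k s.
have pos j : 0 <= coef h j * monomial (freq h j) s.
  by have [? ?] := nth_nonneg j hh; rewrite mulr_ge0// monomial_ge0.
have [c0 f0'] := nth_nonneg k hh; split; first exact: monomial_ge0.
rewrite ger0_norm//; have [kh|hk] := ltnP k (size h); last first.
  rewrite {1}/coef nth_default//= mul0r mulr_ge0//.
  by apply: sumr_ge0 => j _; rewrite mulr_ge0.
rewrite (bigD1 (Ordinal kh))//= mulrDl -[X in _ <= X + _]mulrA -exprMn divff//.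
rewrite expr1n mulr1 lerDl mulr_ge0//.
by apply: sumr_ge0 => j _; rewrite mulr_ge0.
Qed.

(** The later humps are kept below [slack i a] times [M 0], so that they change
    the derivative of order [a] by at most [N i a] in norm. *)
Let slack i a : R := N i a / (1 + \sum_(p <- splits (multi_seq a))
  4 * M 0%N (counts p.2) * tibf_norm E (mderiv (counts p.1) f0)).

Let slack_den a : 1 <= 1 + \sum_(p <- splits (multi_seq a))
  4 * M 0%N (counts p.2) * tibf_norm E (mderiv (counts p.1) f0).
Proof.
rewrite lerDl; apply: sumr_ge0 => p _; have [M0 _ _] := wsM 0.
by rewrite !mulr_ge0 ?tibf_norm_ge0// ltW.
Qed.

Let slack_gt0 i a : 0 < slack i a.
Proof. by rewrite divr_gt0// (lt_le_trans _ (slack_den a)). Qed.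

Let admissible h t := [/\ nonneg t,
  forall s, t.1.1 * monomial t.1.2 s <= M (size h) (counts s) * 2^-1 ^+ size h,
  forall i s, (i < size h)%N -> t.1.1 * monomial t.1.2 s <=
    slack i (nth dflt h i).2 * M 0%N (counts s) * 2^-1 ^+ size h &
  (size h).+1%:R * N (size h) t.2 <= tibf_norm E
    (mderiv t.2 (modulate f0 (coef (rcons h t)) (freq (rcons h t))))].

(** If the difference of two functions has a large norm, one of the two is
    large: the new coefficient is either the one for which the modulated
    function alone is large, or zero. *)
Let next_step h : (forall t, t \in h -> nonneg t) -> exists t, admissible h t.
Proof.
move=> hh; set k := size h.
have [e [e0 e1 eh]] : exists e : R, [/\ 0 < e, e <= 1 &
    forall i, (i < k)%N -> e <= slack i (nth dflt h i).2].
  elim: (k) => [|m [e [e0 e1 em]]]; first by exists 1.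
  exists (Num.min e (slack m (nth dflt h m).2)); split.
  - by rewrite lt_min e0 slack_gt0.
  - by rewrite ge_min e1.
  - move=> i; rewrite ltnS leq_eqVlt => /orP[/eqP->|/em ei].
      by rewrite ge_min lexx orbT.
    by rewrite ge_min ei.
pose C := 2 * k.+1%:R / (e * 2^-1 ^+ k * tibf_norm E f0).
have e2 : 0 < e * 2^-1 ^+ k by rewrite mulr_gt0// exprn_gt0// invr_gt0.
have C0 : 0 < C by rewrite divr_gt0 ?mulr_gt0.
have [a Ca] := MN k C0.
have [x x0 xM] := log_convex_support (wsM k) (lcM k) a.
have [Mk0 _ _] := wsM k.
have ma : 0 < monomial x (multi_seq a) by exact: monomial_gt0.
pose c := e * 2^-1 ^+ k * M k a / monomial x (multi_seq a).
have c0 : 0 <= c by rewrite divr_ge0 ?(ltW ma)// mulr_ge0 ?(ltW e2)// ltW.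
have [s /andP[s0 s1] low] := modulate_lower_bound solidE smooth0 E0 a x0 c0.
have sx0 i : 0 <= (s *: x) 0 i by rewrite mxE mulr_ge0// ltW.
have cM u : c * monomial (s *: x) u <= e * 2^-1 ^+ k * M k (counts u).
  have mu0 : 0 <= monomial x u by apply: monomial_ge0 => i; exact: ltW.
  apply: (@le_trans _ _ (c * monomial x u)).
    by rewrite ler_wpM2l// monomialZ ler_piMl// exprn_ile1.
  rewrite /c -!mulrA ler_wpM2l ?(ltW e0)// ler_wpM2l ?exprn_ge0//.
  by rewrite mulrC -mulrA ler_pdivrMl// mulrC -[leRHS]mulrC mulrC; exact: xM.
have bound z : z = c \/ z = 0 ->
  [/\ nonneg (z, s *: x, a),
  forall s', z * monomial (s *: x) s' <= M k (counts s') * 2^-1 ^+ k &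
  forall i s', (i < k)%N -> z * monomial (s *: x) s' <=
    slack i (nth dflt h i).2 * M 0%N (counts s') * 2^-1 ^+ k].
  have h0 : 0 <= 2^-1 ^+ k :> R by rewrite exprn_ge0.
  move=> zc; have z0 : 0 <= z by case: zc => ->.
  have zM u : z * monomial (s *: x) u <= e * 2^-1 ^+ k * M k (counts u).
    by case: zc => ->; rewrite ?cM// mul0r mulr_ge0 ?(ltW e2)// ltW.
  split; first by split.
    move=> u; apply: (le_trans (zM u)); rewrite mulrC ler_wpM2l ?(ltW (Mk0 _))//.
    by rewrite ler_piMl.
  move=> i u ik; apply: (le_trans (zM u)); rewrite -mulrA [leRHS]mulrAC -[leRHS]mulrA.
  by apply: ler_pM; rewrite ?(ltW e0) ?eh ?mulr_ge0 ?(ltW (Mk0 _))// ler_wpM2l.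
pose T z : step := (z, s *: x, a).
have hT z : 0 <= z -> forall t, t \in rcons h (T z) -> nonneg t.
  by move=> z0 t; rewrite mem_rcons inE => /orP[/eqP ->|/hh].
have coefT z j : coef (rcons h (T z)) j = if j == k then z else coef h j.
  rewrite /coef nth_rcons -/k; case: ltngtP => // jk.
  by rewrite nth_default// ltnW.
have freqT z : freq (rcons h (T z)) = freq (rcons h (T 0)).
  by apply/funext => j; rewrite /freq !nth_rcons; case: ltngtP.
pose xi := freq (rcons h (T 0)).
have xi0 j i : 0 <= xi j 0 i.
  by have [_] := nth_nonneg j (hT 0 (lexx 0)).
have xik : xi k = s *: x by rewrite /xi /freq nth_rcons ltnn eqxx.
have singleE : single k c = fun j => coef (rcons h (T c)) j - coef (rcons h (T 0)) j.
  apply/funext => j; rewrite !coefT /single.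
  by case: eqP; rewrite ?subr0 ?subrr.
have bKc := rapid_history (hT c c0); have bK0 := rapid_history (hT 0 (lexx 0)).
rewrite freqT -/xi in bKc; rewrite -/xi in bK0.
have := low k xi xi0 xik; rewrite singleE (mderiv_modulateB smooth0 a bKc bK0).
have [EC _] := norm_modulate solidE smooth0 E0 a bKc.
have [EZ _] := norm_modulate solidE smooth0 E0 a bK0.
set D := (2 * expR 1) ^+ mdeg a => low'.
have D0 : 0 < D by rewrite exprn_gt0// mulr_gt0// expR_gt0.
have big : 2 * (k.+1%:R * N k a) <=
    tibf_norm E (mderiv a (modulate f0 (coef (rcons h (T c))) xi)) +
    tibf_norm E (mderiv a (modulate f0 (coef (rcons h (T 0))) xi)).
  apply: le_trans (tibf_normB EC EZ); rewrite -(ler_pM2l D0).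
  apply: le_trans low'; rewrite /c divfK ?lt0r_neq0//.
  apply: (@le_trans _ _ (e * 2^-1 ^+ k * tibf_norm E f0 * (C * D * N k a))).
    have en : e * 2^-1 ^+ k * tibf_norm E f0 != 0 by rewrite lt0r_neq0// mulr_gt0.
    have -> : e * 2^-1 ^+ k * tibf_norm E f0 * (C * D * N k a) =
      (e * 2^-1 ^+ k * tibf_norm E f0 * C) * D * N k a by ring.
    rewrite /C mulrC [X in _ <= X * _ * _]mulrC divfK//.
    by rewrite le_eqVlt; apply/orP; left; apply/eqP; ring.
  rewrite mulrAC ler_wpM2r ?(ltW norm0)// ler_wpM2l ?(ltW e2)//.
  exact: ltW.
have [cbig|csmall] := leP (k.+1%:R * N k a)
    (tibf_norm E (mderiv a (modulate f0 (coef (rcons h (T c))) xi))).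
  exists (T c); have [b1 b2 b3] := bound c (or_introl erefl).
  by split=> //; rewrite freqT.
exists (T 0); have [b1 b2 b3] := bound 0 (or_intror erefl).
split=> //; rewrite -/xi; move: big csmall; rewrite -/k /=.
by move: (tibf_norm _ _) (tibf_norm _ _) => u v; lra.
Qed.

(** If [M k] beats any multiple of [N k], even after losing a geometric factor,
    a single superposition of waves violates all the corresponding bounds at
    once: it is built term by term with [next_step], and the terms that come
    after the [k]-th one are too small to spoil the derivative of order
    [al k]. *)
Lemma gliding_hump : exists (b : nat -> R) (xi : nat -> 'rV[R]_n)
    (al : nat -> multi n),
  [/\ forall k, 0 <= b k, forall k i, 0 <= xi k 0 i,
      forall k s, b k * monomial (xi k) s <= M k (counts s) * 2^-1 ^+ k &
      forall k, k%:R * N k (al k) <= tibf_norm E (mderiv (al k) (modulate f0 b xi))].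
Proof.
have [next nextP] : {next : seq step -> step & forall h,
    (forall t, t \in h -> nonneg t) -> admissible h (next h)}.
  apply: (@choice _ _ (fun h t => (forall t, t \in h -> nonneg t) -> admissible h t)).
  move=> h; have [hh|nh] := pselect (forall t, t \in h -> nonneg t).
    by have [t ?] := next_step hh; exists t.
  by exists dflt.
pose hist k := iter k (fun h => rcons h (next h)) [::].
pose t k := next (hist k).
have histE k : hist k = mkseq t k.
  by elim: k => //= k IH; rewrite mkseqS -IH.
have shist k : size (hist k) = k by rewrite histE size_mkseq.
have hh k : forall u, u \in hist k -> nonneg u.
  elim: k => // k IH u; rewrite /= mem_rcons inE => /orP[/eqP ->|/IH //].
  by have [] := nextP _ IH.
have adm k : admissible (hist k) (t k) by exact: nextP (hh k).
pose b k := (t k).1.1; pose xi k := (t k).1.2; pose al k := (t k).2.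
have b0 k : 0 <= b k by have [[]] := adm k.
have xi0 k i : 0 <= xi k 0 i by have [[_ ]] := adm k.
have bM k s : b k * monomial (xi k) s <= M k (counts s) * 2^-1 ^+ k.
  by have [_ + _ _] := adm k; rewrite shist; exact.
exists b, xi, al; split=> // k.
have bK : rapid b xi (fun s => M 0%N (counts s)).
  move=> j s; split; first exact: monomial_ge0.
  rewrite ger0_norm//; apply: (le_trans (bM j s)).
  by rewrite ler_wpM2r// exprn_ge0.
pose tail j := if (j <= k)%N then 0 else b j.
pose S s := slack k (al k) * M 0%N (counts s).
have S0 s : 0 <= S s.
  by have [M0 _ _] := wsM 0; rewrite mulr_ge0// ltW.
have tailS : rapid tail xi S.
  move=> j s; split; first exact: monomial_ge0.
  rewrite /tail; have [jk|kj] := leqP j k.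
    by rewrite normr0 mul0r mulr_ge0// exprn_ge0.
  have [_ _ /(_ k s) + _] := adm j; rewrite shist => /(_ kj).
  by rewrite histE nth_mkseq// ger0_norm.
have [_ _ _ large] := adm k.
have historyE : modulate f0 (coef (hist k.+1)) (freq (hist k.+1)) =
    modulate f0 (fun j => b j - tail j) xi.
  have cE j : coef (hist k.+1) j = b j - tail j.
    rewrite /coef /tail histE; have [jk|kj] := leqP j k.
      by rewrite nth_mkseq ?ltnS// subr0.
    by rewrite nth_default ?size_mkseq// subrr.
  rewrite -(funext cE); apply: eq_modulate => j; rewrite cE /tail.
  have [jk _|kj] := leqP j k; last by rewrite subrr eqxx.
  by rewrite /freq histE nth_mkseq.
move: large; rewrite -[rcons _ _]/(hist k.+1) historyE shist -/(al k).
rewrite (mderiv_modulateB smooth0 _ bK tailS).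
have [EB _] := norm_modulate solidE smooth0 E0 (al k) bK.
have [ET tailN] := norm_modulate solidE smooth0 E0 (al k) tailS.
move=> /le_trans/(_ (tibf_normB EB ET)).
have : tibf_norm E (mderiv (al k) (modulate f0 tail xi)) <= N k (al k).
  apply: (le_trans tailN).
  rewrite (eq_bigr (fun p => slack k (al k) * (4 * M 0%N (counts p.2) *
    tibf_norm E (mderiv (counts p.1) f0)))); last by move=> p _; rewrite /S; ring.
  rewrite -mulr_sumr /slack mulrAC ler_pdivrMr ?(lt_le_trans _ (slack_den _))//.
  by rewrite ler_wpM2l ?(ltW (N_gt0 _ _))// lerDr.
by rewrite -natr1 mulrDl mul1r; lra.
Qed.

End GlidingHump.

(** * Gelfand-Shilov spaces *)

Section WeightedSpaces.
Context (R : realType) (n : nat) (E : tibf R n) (solidE : solid E).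
Implicit Types (M : multi n -> R) (w : 'rV[R]_n -> R) (f : cfun R n).

Lemma space_EMwP M w f : (forall a, 0 < M a) ->
  space_EMw E M w f <->
  [/\ csmooth f, forall a, tibf_set E (weighted w (mderiv a f)) &
      exists B, forall a, tibf_norm E (weighted w (mderiv a f)) <= B * M a].
Proof.
move=> M0; split=> [[sf Ef fin]|[sf Ef [B fB]]]; split=> //.
  have le_sup a : ((tibf_norm E (weighted w (mderiv a f)) / M a)%:E <=
      norm_EMw E M w f)%E by apply: ereal_sup_ubound; exists a.
  case: (norm_EMw E M w f) fin le_sup => [r _ le_sup|//|_ /(_ 0)]; last first.
    by rewrite leNgt ltNyr.
  by exists r => a; rewrite -ler_pdivrMr// -lee_fin.
apply: (@le_lt_trans _ _ B%:E); last exact: ltry.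
apply: ge_ereal_sup => _ [a _ <-].
by rewrite lee_fin ler_pdivrMr.
Qed.

Lemma space_EMw_le M M' w w' f : (forall a, 0 < M a) ->
  (forall a, M a <= M' a) ->
  continuous w' -> (forall x, 0 <= w' x <= w x) ->
  space_EMw E M w f -> space_EMw E M' w' f.
Proof.
move=> M0 MM' cw' ww' /(space_EMwP _ _ M0)[sf Ef [B fB]].
have M'0 a : 0 < M' a by exact: lt_le_trans (MM' a).
have cw : ccontinuous (fun x : 'rV[R]_n => Complex (w' x) 0).
  by split=> //; exact: cst_continuous.
have Ef' a : tibf_set E (weighted w' (mderiv a f)) /\
    tibf_norm E (weighted w' (mderiv a f)) <= tibf_norm E (weighted w (mderiv a f)).
  apply: (solid_le solidE (Ef a)) => [|x].
    apply: ccontinuous_measurable; apply: ccontinuousM cw.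
    exact: (csmooth_continuous (multi_seq a) sf).
  have /andP[w0 wx] := ww' x.
  rewrite !cmodM !cmod_real !ger0_norm ?(le_trans w0)// ler_wpM2l//.
  exact: cmod_ge0.
apply/(space_EMwP _ _ M'0); split=> // [a|]; first by case: (Ef' a).
have B0 : 0 <= B.
  by rewrite -(pmulr_lge0 _ (M0 0)) (le_trans (tibf_norm_ge0 (Ef 0)))// mulrC fB.
exists B => a; have [_ le1] := Ef' a; apply: (le_trans le1).
by apply: (le_trans (fB a)); rewrite ler_wpM2l.
Qed.

Lemma space_EMw0 M w : (forall a, 0 < M a) -> space_EMw E M w (fun=> 0).
Proof.
move=> M0; have W0 a : weighted w (mderiv a (fun=> 0)) = fun=> 0 :> R[i].
  apply/funext => x; rewrite /weighted.
  by rewrite [mderiv _ _](cpartials0 R (multi_seq a)) mul0r.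
apply/space_EMwP => //; split.
- apply: csmoothP => s; rewrite cpartials0; first by split; exact: cst_continuous.
  by move=> i x; split; exact: (derivable_cst (0 : R) x (delta_mx 0 i)).
- by move=> a; rewrite W0; exact: tibf_set0.
- by exists 0 => a; rewrite W0 tibf_norm0 mul0r.
Qed.

(** The power of two is the number of terms in the Leibniz rule. *)
Definition product_bound M M' := exists2 C, 0 < C &
  forall a b, 2 ^+ mdeg (a + b) * (M a * M b) <= C * M' (a + b).

Lemma modulate_space M M' w f b xi K B : (forall a, 0 < M a) ->
  (forall a, 0 < M' a) -> product_bound M M' ->
  space_EMw E M w f -> rapid b xi K -> (forall s, K s <= B * M (counts s)) ->
  space_EMw E M' w (modulate f b xi).
Proof.
move=> M0 M'0 [C C0 MM'] /(space_EMwP _ _ M0)[sf Ef [A fA]] bK KB.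
apply/(space_EMwP _ _ M'0); split; first exact: csmooth_modulate sf _ _ _ bK.
  by move=> a; have [] := weighted_modulate solidE sf a Ef bK.
have B0 : 0 <= B.
  rewrite -(pmulr_lge0 _ (M0 (counts [::]))) mulrC.
  by rewrite mulrC (le_trans _ (KB [::]))// (rapid_ge0 _ bK).
have A0 : 0 <= A.
  by rewrite -(pmulr_lge0 _ (M0 0)) (le_trans (tibf_norm_ge0 (Ef 0)))// mulrC fA.
exists (4 * B * A * C) => a; have [_ le1] := weighted_modulate solidE sf a Ef bK.
apply: (le_trans le1).
have term p : p \in splits (multi_seq a) ->
    4 * K p.2 * tibf_norm E (weighted w (mderiv (counts p.1) f)) <=
    4 * B * A * C * M' a * 2^-1 ^+ mdeg a.
  move=> /splits_multi[_ _ pa].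
  rewrite [leRHS](_ : _ = 4 * (B * A * (2^-1 ^+ mdeg a * (C * M' a)))); last by ring.
  rewrite -mulrA ler_wpM2l//.
  apply: (@le_trans _ _ (B * M (counts p.2) * (A * M (counts p.1)))).
    by apply: ler_pM => //; rewrite ?(rapid_ge0 _ bK)// tibf_norm_ge0.
  rewrite [leLHS](_ : _ = B * A * (M (counts p.1) * M (counts p.2))); last by ring.
  by rewrite ler_wpM2l ?mulr_ge0// exprVn ler_pdivlMl ?exprn_gt0// -pa MM'.
rewrite big_seq; apply: (le_trans (ler_sum _ term)).
rewrite -big_seq big_const_seq count_predT size_splits size_multi_seq iter_addr_0.
rewrite -[leLHS]mulr_natr natrX -[leLHS]mulrA -exprMn mulVf// expr1n mulr1.
by [].
Qed.

Lemma norm_mderiv_bound M w f : (forall a, 0 < M a) -> (forall x, 1 <= w x) ->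
  space_EMw E M w f ->
  (forall a, tibf_set E (mderiv a f)) /\
  exists2 B, 0 <= B & forall a, tibf_norm E (mderiv a f) <= B * M a.
Proof.
move=> M0 w1 fE.
have w01 x : 0 <= (1 : R) <= w x by rewrite ler01 w1.
have := space_EMw_le M0 (fun a => lexx (M a)) (@cst_continuous _ _ (1 : R)) w01 fE.
move=> /(space_EMwP _ _ M0)[_ Ef [B fB]].
have Ef' a : tibf_set E (mderiv a f) by rewrite -(weighted1 (mderiv a f)).
split=> //; exists `|B| => // a.
have := fB a; rewrite weighted1 => /le_trans; apply.
by rewrite ler_wpM2r ?ler_norm// ltW.
Qed.

End WeightedSpaces.

Section Systems.
Context (R : realType) (n : nat).
Implicit Types (M N : {posnum R} -> multi n -> R).

Lemma not_sequence_bound (Mm Nl Mk : multi n -> R) (r : R) :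
  0 < r -> ~ sequence_bound Mm Nl -> L_bound r Mm Mk ->
  forall C, 0 < C -> exists a, C * r ^+ mdeg a * Nl a < Mk a.
Proof.
move=> r0 nb [C' C'0 LM] C C0; apply: contrapT => /forallNP H; apply: nb.
exists (C' * C) => [|a]; first exact: mulr_gt0.
have /negP := H a; rewrite -leNgt => MN.
have rd : 0 < r ^+ mdeg a by exact: exprn_gt0.
rewrite -(ler_pM2l rd) (le_trans (LM a))//.
apply: (le_trans (ler_wpM2l (ltW C'0) MN)).
by rewrite le_eqVlt; apply/orP; left; apply/eqP; ring.
Qed.

Lemma I_L_product_bound (M1 M2 M3 P : multi n -> R) C H :
  0 < C -> 0 < H -> (forall a, 0 < P a) ->
  (forall a b, M1 a * M2 b <= C * H ^+ mdeg (a + b) * M3 (a + b)) ->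
  L_bound (2 * H) P M1 -> L_bound (2 * H) P M2 -> product_bound P M3.
Proof.
move=> C0 H0 P0 IM [C1 C10 L1] [C2 C20 L2].
exists (C1 * C2 * C) => [|a b]; first by rewrite !mulr_gt0.
have dab : mdeg (a + b) = (mdeg a + mdeg b)%N.
  by rewrite /mdeg -big_split; apply: eq_bigr => i _; rewrite ffunE.
have Hd : 0 < H ^+ mdeg (a + b) by exact: exprn_gt0.
rewrite -(ler_pM2l Hd).
have -> : H ^+ mdeg (a + b) * (2 ^+ mdeg (a + b) * (P a * P b)) =
    ((2 * H) ^+ mdeg a * P a) * ((2 * H) ^+ mdeg b * P b).
  by rewrite dab !exprMn !exprD; ring.
apply: (@le_trans _ _ (C1 * M1 a * (C2 * M2 b))).
  have H2 : 0 <= 2 * H by rewrite mulr_ge0// ltW.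
  by apply: ler_pM => //; rewrite mulr_ge0 ?exprn_ge0// ltW.
have -> : C1 * M1 a * (C2 * M2 b) = C1 * C2 * (M1 a * M2 b) by ring.
have CC : 0 <= C1 * C2 by rewrite mulr_ge0// ltW.
apply: (le_trans (ler_wpM2l CC (IM a b))).
by rewrite le_eqVlt; apply/orP; left; apply/eqP; ring.
Qed.

End Systems.

Section Indices.
Context (R : realType) (n : nat).
Implicit Types (M : {posnum R} -> multi n -> R).

Lemma posnum_lower (a b : {posnum R}) :
  exists c : {posnum R}, c%:num <= a%:num /\ c%:num <= b%:num.
Proof. by have [ab|/ltW ba] := leP a%:num b%:num; [exists a|exists b]. Qed.

Lemma posnum_upper (a b : {posnum R}) :
  exists c : {posnum R}, a%:num <= c%:num /\ b%:num <= c%:num.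
Proof. by have [ab|/ltW ba] := leP a%:num b%:num; [exists b|exists a]. Qed.

Lemma L_bound_le (r : R) (P P' Q : multi n -> R) : 0 <= r ->
  (forall a, P' a <= P a) -> L_bound r P Q -> L_bound r P' Q.
Proof.
move=> r0 PP [C C0 H]; exists C => // a.
by rewrite (le_trans (ler_wpM2l _ (PP a))) ?exprn_ge0.
Qed.

Lemma cond_IL_Beurling M : weight_sequence_system M -> cond_L Beurling M ->
  cond_I Beurling M -> forall l, exists2 m : {posnum R}, m%:num <= l%:num &
  product_bound (M m) (M l).
Proof.
move=> [wsM monoM] LM IM l; have M0 k a : 0 < M k a by have [] := wsM k.
have [m1 [m2 [C [H [C0 H0 MI]]]]] := IM l.
have H2 : 0 < 2 * H by rewrite mulr_gt0.
have [p1 L1] := LM _ H2 m1; have [p2 L2] := LM _ H2 m2.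
have [p [pp1 pp2]] := posnum_lower p1 p2; have [q [qp ql]] := posnum_lower p l.
have q1 := le_trans qp pp1; have q2 := le_trans qp pp2.
exists q => //; apply: (I_L_product_bound C0 H0 (M0 q) MI).
  exact: (L_bound_le (ltW H2) (monoM _ _ q1) L1).
exact: (L_bound_le (ltW H2) (monoM _ _ q2) L2).
Qed.

Lemma cond_IL_Roumieu M : weight_sequence_system M -> cond_L Roumieu M ->
  cond_I Roumieu M -> forall m, exists l : {posnum R},
  product_bound (M m) (M l).
Proof.
move=> [wsM monoM] LM IM m; have M0 k a : 0 < M k a by have [] := wsM k.
have [l [C [H [C0 H0 MI]]]] := IM m m.
have H2 : 0 < 2 * H by rewrite mulr_gt0.
have [l' [C' C'0 L']] := LM _ H2 l.
exists l', (C * C') => [|a b]; first exact: mulr_gt0.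
have Hd : 0 < H ^+ mdeg (a + b) by exact: exprn_gt0.
rewrite -(ler_pM2l Hd).
apply: (@le_trans _ _ (2 ^+ mdeg (a + b) * H ^+ mdeg (a + b) *
    (C * H ^+ mdeg (a + b) * M l (a + b)))).
  rewrite [leLHS](_ : _ = 2 ^+ mdeg (a + b) * H ^+ mdeg (a + b) * (M m a * M m b)).
    by rewrite ler_wpM2l// mulr_ge0// ltW.
  by ring.
have := L' (a + b); rewrite exprMn => L''.
rewrite [leLHS](_ : _ = C * H ^+ mdeg (a + b) *
  (2 ^+ mdeg (a + b) * H ^+ mdeg (a + b) * M l (a + b))); last by ring.
rewrite [leRHS](_ : _ = C * H ^+ mdeg (a + b) * (C' * M l' (a + b))); last by ring.
by rewrite ler_wpM2l// mulr_ge0 ?(ltW C0) ?(ltW Hd).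
Qed.

(** Finitely many terms are controlled by any weight sequence, since each of
    them has a single frequency. *)
Lemma rapid_tail (b : nat -> R) (xi : nat -> 'rV[R]_n) (Mk : nat -> multi n -> R)
    (M0 : multi n -> R) k0 : weight_sequence M0 ->
  (forall k, 0 <= b k) -> (forall k i, 0 <= xi k 0 i) ->
  (forall k s, b k * monomial (xi k) s <= Mk k (counts s) * 2^-1 ^+ k) ->
  (forall k a, (k0 <= k)%N -> Mk k a <= M0 a) ->
  exists B, rapid b xi (fun s => B * M0 (counts s)).
Proof.
move=> wsM b0 xi0 bM MM; have [M0_gt0 _ _] := wsM.
have [C CP] : {C : nat -> R & forall k, 0 < C k /\
    forall s, monomial (xi k) s <= C k * M0 (counts s)}.
  apply: (@choice _ _ (fun k c => 0 < c /\
    forall s, monomial (xi k) s <= c * M0 (counts s))) => k.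
  have [c c0 cM] := weight_sequence_dominates wsM (xi k).
  by exists c; split=> // s; apply: (le_trans (ler_norm _)).
pose S := \sum_(k < k0) b k * C k * 2 ^+ k.
have term0 k : 0 <= b k * C k * 2 ^+ k.
  by have [/ltW C0 _] := CP k; rewrite !mulr_ge0.
have S0 : 0 <= S by apply: sumr_ge0.
exists (1 + S) => k s; split; first exact: monomial_ge0.
have Ms := M0_gt0 (counts s); have h0 : 0 <= 2^-1 ^+ k :> R by rewrite exprn_ge0.
rewrite ger0_norm//; have [kk|kk] := leqP k0 k.
  rewrite (le_trans (bM k s))// ler_wpM2r//.
  by rewrite (le_trans (MM _ _ kk))// ler_peMl ?(ltW Ms)// lerDl.
have [_ /(_ s)/(ler_wpM2l (b0 k))] := CP k; move/le_trans; apply.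
have -> : b k * (C k * M0 (counts s)) = b k * C k * 2 ^+ k * M0 (counts s) * 2^-1 ^+ k.
  have two : 2 ^+ k * 2^-1 ^+ k = 1 :> R by rewrite -exprMn divff// expr1n.
  transitivity (b k * C k * M0 (counts s) * (2 ^+ k * 2^-1 ^+ k)); last by ring.
  by rewrite two; ring.
rewrite ler_wpM2r// ler_wpM2r ?(ltW Ms)// /S (bigD1 (Ordinal kk))//= addrCA lerDl.
by rewrite addr_ge0// sumr_ge0.
Qed.

Lemma GS_space_neq0 (c : bracket) (E : tibf R n) M (W : {posnum R} -> 'rV[R]_n -> R) :
  weight_sequence_system M -> GS_space c E M W <> [set fun=> 0] ->
  exists2 f, GS_space c E M W f & exists x, f x != 0.
Proof.
move=> [wsM _] neq; apply: contrapT => H; apply: neq.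
have M0 k a : 0 < M k a by have [] := wsM k.
apply/seteqP; split=> [f Gf|_ ->] /=; last first.
  case: c H => _ /=; first by move=> l _; exact: space_EMw0.
  by exists 1%:pos => //; exact: space_EMw0.
apply/funext => x; apply: contrapT => /eqP fx; apply: H.
by exists f => //; exists x.
Qed.

Lemma natmul_unbounded (B : R) (u : nat -> R) (k0 : nat) : (forall k, 0 < u k) ->
  ~ (forall k, (k0 <= k)%N -> k%:R * u k <= B * u k).
Proof.
move=> u0 H; pose k := maxn k0 (Num.truncn B).+1.
have := H k (leq_maxl _ _); rewrite ler_pM2r// leNgt => /negP; apply.
by rewrite (lt_le_trans (truncnS_gt B))// ler_nat leq_maxr.
Qed.

End Indices.

(** * The inclusion of the weight sequence systems *)

Theorem theorem3p2 (R : realType) (n : nat) (c : bracket) (E : tibf R n)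
    (M N : {posnum R} -> multi n -> R) (W V : {posnum R} -> 'rV[R]_n -> R)
    (solidE : solid E)
    (sysM : weight_sequence_system M) (sysN : weight_sequence_system N)
    (sysW : weight_function_system W) (sysV : weight_function_system V)
    (lcM : log_convex M) (LM : cond_L c M) (IM : cond_I c M)
    (LN : cond_L c N) (wIN : cond_wI c N)
    (wMW : cond_wM c W) (wMV : cond_wM c V)
    (nontrivial : GS_space c E M W <> [set fun=> 0])
    (sub : GS_space c E M W `<=` GS_space c E N V) :
  system_sub c M N.
Proof.
have [f0 Gf0 [x0 fx0]] := GS_space_neq0 sysM nontrivial.
have [wsM monoM] := sysM; have [wsN monoN] := sysN.
have [wW monoW] := sysW; have [wV monoV] := sysV.
have M0 k a : 0 < M k a by have [] := wsM k.
have N0 k a : 0 < N k a by have [] := wsN k.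
have W1 l x : 1 <= W l x by have [] := wW l.
have V1 l x : 1 <= V l x by have [] := wV l.
have W01 l m : m%:num <= l%:num -> forall x, 0 <= W l x <= W m x.
  by move=> ml x; rewrite (le_trans ler01 (W1 l x)) monoW.
have contW l : continuous (W l) by have [] := wW l.
have r0 : 0 < 2 * expR 1 :> R by rewrite mulr_gt0// expR_gt0.
have [l0 f0E] : exists l, space_EMw E (M l) (W l) f0.
  by case: (c) Gf0 => [Gf0|[l _ ?]]; [exists 1%:pos; exact: Gf0|exists l].
have [sf0 _ _] := f0E.
have [E0 _] := norm_mderiv_bound solidE (M0 l0) (W1 l0) f0E.
have norm0 : 0 < tibf_norm E f0.
  apply: (tibf_norm_gt0 _ _ fx0); last by rewrite -(mderiv0 f0).
  by rewrite -(mderiv0 f0); exact: (csmooth_continuous (multi_seq 0) sf0).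
case: c LM IM LN wIN wMW wMV nontrivial sub Gf0 => LM IM _ _ _ _ _ sub Gf0.
(* Beurling: [l] is fixed and the humps are taken along [M (e k)] with [e k]
   tending to zero, so that their superposition lies in all the spaces. *)
- move=> l; apply: contrapT => /forallNP nb.
  have e0 (k : nat) : 0 < k.+1%:R^-1 :> R by rewrite invr_gt0.
  pose e (k : nat) : {posnum R} := PosNum (e0 k).
  have [|||||b [xi [al [b0 xi0 bM large]]]] := @gliding_hump R n E solidE f0 sf0
    E0 norm0 (fun k => M (e k)) (fun=> N l).
  + by move=> k; exact: wsM.
  + by move=> k; exact: lcM.
  + by move=> k a; apply: monoM; rewrite /= lef_pV2 ?posrE// ler_nat.
  + by move=> k; exact: N0.
  + move=> k; have [m Lm] := LM _ r0 (e k).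
    exact: not_sequence_bound r0 (nb m) Lm.
  have Gf : GS_space Beurling E M W (modulate f0 b xi).
    move=> l1 _; have [m ml1 PM] := cond_IL_Beurling sysM LM IM l1.
    pose k0 := Num.truncn (m%:num)^-1.
    have [k a k0k|B bK] := rapid_tail (Mk := fun k => M (e k)) (k0 := k0) (wsM m) b0 xi0 bM.
      apply: monoM; rewrite /= invf_ple ?posrE//.
      by rewrite (le_trans (ltW (truncnS_gt _)))// ler_nat.
    have f0m := space_EMw_le solidE (M0 m) (fun a => lexx _) (contW l1)
      (W01 _ _ ml1) (Gf0 m I).
    exact: (modulate_space solidE (M0 m) (M0 l1) PM f0m bK (fun s => lexx _)).
  have [_ [B B0 fB]] := norm_mderiv_bound solidE (N0 l) (V1 l) (sub _ Gf l I).
  apply: (natmul_unbounded (B := B) (k0 := 0) (u := fun k => N l (al k))) => // k _.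
  exact: le_trans (large k) (fB _).
(* Roumieu: the humps are taken along a fixed [M m'] against [N (e k)] with
   [e k] tending to infinity. *)
- move=> m; apply: contrapT => /forallNP nb.
  have [m' Lm] := LM _ r0 m.
  have e0 (k : nat) : 0 < k.+1%:R :> R by [].
  pose e (k : nat) : {posnum R} := PosNum (e0 k).
  have [|||||b [xi [al [b0 xi0 bM large]]]] := @gliding_hump R n E solidE f0 sf0
    E0 norm0 (fun=> M m') (fun k => N (e k)).
  + by move=> k; exact: wsM.
  + by move=> k; exact: lcM.
  + by move=> k a.
  + by move=> k; exact: N0.
  + by move=> k; exact: not_sequence_bound r0 (nb _) Lm.
  have [v [l0v m'v]] := posnum_upper l0 m'.
  have [v' PM] := cond_IL_Roumieu sysM LM IM v.
  have [l1 [v'l1 l0l1]] := posnum_upper v' l0.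
  have Gf : GS_space Roumieu E M W (modulate f0 b xi).
    exists l1 => //.
    have f0v := space_EMw_le solidE (M0 l0) (monoM _ _ l0v) (contW l0)
      (W01 _ _ (lexx _)) f0E.
    have bK : rapid b xi (fun s => M v (counts s)).
      move=> k s; split; first exact: monomial_ge0.
      rewrite ger0_norm// (le_trans (bM k s))// ler_wpM2r ?exprn_ge0//.
      exact: monoM.
    have Gv' : space_EMw E (M v') (W l0) (modulate f0 b xi).
      apply: (modulate_space (B := 1) solidE (M0 v) (M0 v') PM f0v bK) => s.
      by rewrite mul1r.
    exact: (space_EMw_le solidE (M0 v') (monoM _ _ v'l1) (contW l1)
      (W01 _ _ l0l1) Gv').
  have [l _ fl] := sub _ Gf.
  have [_ [B B0 fB]] := norm_mderiv_bound solidE (N0 l) (V1 l) fl.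
  apply: (natmul_unbounded (B := B) (k0 := Num.truncn l%:num)
    (u := fun k => N (e k) (al k))) => // k lk.
  apply: (le_trans (large k)); apply: (le_trans (fB _)); rewrite ler_wpM2l//.
  apply: monoN; rewrite /= (le_trans (ltW (truncnS_gt _)))// ler_nat//.
Qed.
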